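(* Let $n\ge 2$. For all Hessenberg functions $h:[n]\to[n]$ and all $\mathsf{x}$ in the minimal sheet $\mathfrak{g}_{(2,1^{n-2})}$, the morphism $\varphi_{\mathsf{x},h}:\mathcal{Y}_{\mathsf{x}_t,h}\to\operatorname{Spec}\mathbb{C}[t]$, where $\mathsf{x}_t$ is the sheet line associated with $\mathsf{x}$, is flat. In particular, every matrix Hessenberg scheme $\mathcal{Y}_{\mathsf{x},h}$ over the minimal sheet admits a flat degeneration to the minimal nilpotent matrix Hessenberg scheme $\mathcal{Y}_{\mathsf{n},h}$, where $\mathsf{n}$ is an element of the minimal nilpotent orbit (the conjugacy class of $E_{1n}$).
   Context: Let $[n]=\{1,\dots,n\}$. A Hessenberg function is a map $h:[n]\to[n]$ with $h(i)\le h(i+1)$ for $i<n$ and $h(i)\ge i$ for all $i$. Let $\mathbf{z}=\{z_{ij}\mid 1\le i,j\le n\}$, $Z=(z_{ij})$, $d=\det Z$, and let $v_j=\sum_i z_{ij}e_i$ be the $j$-th column of $Z$. For a polynomial ring $R$ over $\mathbb{C}$ (here $R=\mathbb{C}$ or $R=\mathbb{C}[t]$) and $\mathsf{x}\in M_n(R)$: for each $i$ with $h(i)<n$ let $\mathcal{I}_{\mathsf{x},h,i}\subseteq R[\mathbf{z}]$ be the ideal generated by all $(h(i)+1)\times(h(i)+1)$ minors of the $n\times(i+h(i))$ matrix $[\mathsf{x}v_1\ \cdots\ \mathsf{x}v_i\ v_1\ \cdots\ v_{h(i)}]$, and $\mathcal{I}_{\mathsf{x},h,i}=0$ if $h(i)=n$.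 Put $\mathcal{I}_{\mathsf{x},h}=\sum_{i\in[n]}\mathcal{I}_{\mathsf{x},h,i}$ and let $\tilde{\mathcal{I}}_{\mathsf{x},h}=\{f\in R[\mathbf{z}]\mid d^kf\in\mathcal{I}_{\mathsf{x},h}\text{ for some }k\ge 0\}$. For $\mathsf{x}\in\mathfrak{gl}_n(\mathbb{C})$ the matrix Hessenberg scheme is $\mathcal{Y}_{\mathsf{x},h}=\operatorname{Spec}\mathbb{C}[\mathbf{z}]/\tilde{\mathcal{I}}_{\mathsf{x},h}$; for $\mathsf{x}_t\in M_n(\mathbb{C}[t])$, $\mathcal{Y}_{\mathsf{x}_t,h}=\operatorname{Spec}\mathbb{C}[t,\mathbf{z}]/\tilde{\mathcal{I}}_{\mathsf{x}_t,h}$, with the morphism to $\operatorname{Spec}\mathbb{C}[t]$ induced by $\mathbb{C}[t]\to\mathbb{C}[t,\mathbf{z}]/\tilde{\mathcal{I}}_{\mathsf{x}_t,h}$. The minimal sheet $\mathfrak{g}_{(2,1^{n-2})}$ consists of the matrices conjugate to $\operatorname{diag}(c_1,c_2,\dots,c_2)$ with $c_1\ne c_2$, or to $cI_n+E_{n-1,n}$ with $c\in\mathbb{C}$, where $E_{ij}$ is the matrix unit. For $\mathsf{x}$ in the minimal sheet, the sheet line associated with $\mathsf{x}$ is $\mathsf{x}_t=t\,\operatorname{diag}(c_1,c_2,\dots,c_2)+E_{1n}$ in the first case and $\mathsf{x}_t=tc\,I_n+E_{n-1,n}$ in the second. A scheme $\mathcal{Y}$ admits a flat degeneration to $\mathcal{Y}_0$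 if there is a flat morphism $\mathcal{Y}_t\to\operatorname{Spec}\mathbb{C}[t]$ whose scheme-theoretic fiber over $\langle t-a\rangle$ is isomorphic to $\mathcal{Y}$ for every $a\ne0$ and whose scheme-theoretic fiber over $\langle t\rangle$ is $\mathcal{Y}_0$. *)

(* Defs.v *)
From HB Require Import structures.
From mathcomp Require Import all_boot all_order all_algebra.
From mathcomp Require Import generic_quotient ring_quotient.
From mathcomp Require Import boolp classical_sets reals complex mpoly.

Set Implicit Arguments.
Unset Strict Implicit.
Unset Printing Implicit Defensive.

Import GRing.Theory.

Local Open Scope classical_set_scope.
Local Open Scope ring_scope.
Local Open Scope quotient_scope.

(* Ideals are not required to be proper, so quotients are only comPzRingTypes;
   this is why {ideal_quot _} of ring_quotient is not used. *)
Record ideal (A : comPzRingType) := Ideal {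
  ideal_set :> A -> Prop;
  ideal_0 : ideal_set 0;
  ideal_D : forall x y, ideal_set x -> ideal_set y -> ideal_set (x + y);
  ideal_M : forall a x, ideal_set x -> ideal_set (a * x) }.

Section IdealConstructions.
Variable A : comPzRingType.

Definition gen_set (G : set A) : set A :=
  [set f | exists2 s : seq (A * A),
     (forall p, p \in s -> G p.2) & f = \sum_(p <- s) p.1 * p.2].

Lemma gen_set0 G : gen_set G 0.
Proof. by exists [::]; rewrite ?big_nil. Qed.

Lemma gen_setD G x y : gen_set G x -> gen_set G y -> gen_set G (x + y).
Proof.
move=> [s sG ->] [t tG ->]; exists (s ++ t); last by rewrite big_cat.
by move=> p; rewrite mem_cat => /orP[/sG|/tG].
Qed.

Lemma gen_setM G a x : gen_set G x -> gen_set G (a * x).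
Proof.
move=> [s sG ->]; exists [seq (a * p.1, p.2) | p <- s].
  by move=> p /mapP[q /sG qG ->].
by rewrite big_map mulr_sumr; apply: eq_bigr => p _; rewrite mulrA.
Qed.

Definition ideal_gen (G : set A) : ideal A :=
  Ideal (gen_set0 G) (@gen_setD G) (@gen_setM G).

Definition sum_set (T : finType) (I : T -> ideal A) : set A :=
  [set f | exists2 g : T -> A, (forall i, I i (g i)) & f = \sum_i g i].

Lemma sum_set0 (T : finType) (I : T -> ideal A) : sum_set I 0.
Proof. by exists (fun=> 0); [move=> i; apply: ideal_0 | rewrite big1]. Qed.

Lemma sum_setD (T : finType) (I : T -> ideal A) x y :
  sum_set I x -> sum_set I y -> sum_set I (x + y).
Proof.
move=> [f fI ->] [g gI ->]; exists (fun i => f i + g i).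
  by move=> i; apply: ideal_D.
by rewrite big_split.
Qed.

Lemma sum_setM (T : finType) (I : T -> ideal A) a x : sum_set I x -> sum_set I (a * x).
Proof.
move=> [f fI ->]; exists (fun i => a * f i); last by rewrite mulr_sumr.
by move=> i; apply: ideal_M.
Qed.

Definition ideal_sum (T : finType) (I : T -> ideal A) : ideal A :=
  Ideal (sum_set0 I) (@sum_setD T I) (@sum_setM T I).

Definition sat_set (d : A) (I : ideal A) : set A :=
  [set f | exists k : nat, I (d ^+ k * f)].

Lemma sat_set0 d I : sat_set d I 0.
Proof. by exists 0%N; rewrite mulr0; apply: ideal_0. Qed.

Lemma sat_setD d I x y : sat_set d I x -> sat_set d I y -> sat_set d I (x + y).
Proof.
move=> [k kx] [l ly]; exists (k + l)%N; rewrite mulrDr.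
apply: ideal_D; first by rewrite exprD (mulrC (d ^+ k)) -mulrA; apply: ideal_M.
by rewrite exprD -mulrA; apply: ideal_M.
Qed.

Lemma sat_setM d I a x : sat_set d I x -> sat_set d I (a * x).
Proof. by move=> [k kx]; exists k; rewrite mulrCA; apply: ideal_M. Qed.

Definition ideal_sat (d : A) (I : ideal A) : ideal A :=
  Ideal (sat_set0 d I) (@sat_setD d I) (@sat_setM d I).

End IdealConstructions.

Section IdealQuotient.
Variables (A : comPzRingType) (I : ideal A).

Definition ideal_pred : {pred A} := fun x => `[< I x >].

Lemma ideal_pred_zmod_closed : zmod_closed ideal_pred.
Proof.
split=> [|x y /asboolP xI /asboolP yI]; apply/asboolP; first exact: ideal_0.
by rewrite -mulN1r; apply: ideal_D => //; apply: ideal_M.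
Qed.

HB.instance Definition _ :=
  GRing.isZmodClosed.Build A ideal_pred ideal_pred_zmod_closed.

Definition quotient : Type := Quotient.quot ideal_pred.

HB.instance Definition _ := GRing.Zmodule.on quotient.
HB.instance Definition _ := EqQuotient.on quotient.

Definition quot_pi (x : A) : quotient := \pi_quotient x.

Lemma quot_piP x y : quot_pi x = quot_pi y <-> I (x - y).
Proof.
by split=> [/eqP|xy]; [rewrite -Quotient.idealrBE => /asboolP |
  apply/eqP; rewrite -Quotient.idealrBE; apply/asboolP].
Qed.

Lemma quot_repr (x : quotient) : quot_pi (repr x) = x.
Proof. exact: reprK. Qed.

Definition quot_one : quotient := quot_pi 1.
Definition quot_mul (x y : quotient) : quotient := quot_pi (repr x * repr y).

Lemma quot_piM x y : quot_pi (x * y) = quot_mul (quot_pi x) (quot_pi y).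
Proof.
apply/esym/quot_piP; set x' := repr _; set y' := repr _.
have xx' : I (x' - x) by apply/quot_piP/quot_repr.
have yy' : I (y' - y) by apply/quot_piP/quot_repr.
have -> : x' * y' - x * y = x' * (y' - y) + y * (x' - x).
  by rewrite !mulrBr addrA (mulrC y x') addrNK (mulrC y).
by apply: ideal_D; apply: ideal_M.
Qed.

Lemma quot_mulA : associative quot_mul.
Proof.
move=> x y z; rewrite -[x]quot_repr -[y]quot_repr -[z]quot_repr.
by rewrite -!quot_piM mulrA.
Qed.

Lemma quot_mulC : commutative quot_mul.
Proof.
by move=> x y; rewrite -[x]quot_repr -[y]quot_repr -!quot_piM mulrC.
Qed.

Lemma quot_mul1 : left_id quot_one quot_mul.
Proof. by move=> x; rewrite -[x]quot_repr -quot_piM mul1r. Qed.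

Lemma quot_piB : zmod_morphism quot_pi.
Proof. by move=> x y; rewrite /quot_pi !piE. Qed.

Lemma quot_mulDl : left_distributive quot_mul +%R.
Proof.
have piD a b : quot_pi (a + b) = quot_pi a + quot_pi b.
  by rewrite /quot_pi !piE.
move=> x y z; rewrite -[x]quot_repr -[y]quot_repr -[z]quot_repr.
by rewrite -piD -!quot_piM -piD mulrDl.
Qed.

HB.instance Definition _ := GRing.Zmodule_isComPzRing.Build quotient
  quot_mulA quot_mulC quot_mul1 quot_mulDl.

HB.instance Definition _ := GRing.isZmodMorphism.Build A quotient
  quot_pi quot_piB.

Lemma quot_pi_monoid_morphism : monoid_morphism quot_pi.
Proof. by split=> // x y; rewrite quot_piM. Qed.

HB.instance Definition _ := GRing.isMonoidMorphism.Build A quotient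
  quot_pi quot_pi_monoid_morphism.

End IdealQuotient.

(* N (x) M over A, built as the commutative monoid of formal sums of pairs
   (lists up to permutation, with concatenation as addition) modulo the
   relations of bilinearity. *)
Section Tensor.
Variables (A : comPzRingType) (N M : lmodType A).

Inductive tens_eq : seq (N * M) -> seq (N * M) -> Prop :=
| Tens_refl s : tens_eq s s
| Tens_sym s t : tens_eq s t -> tens_eq t s
| Tens_trans s t u : tens_eq s t -> tens_eq t u -> tens_eq s u
| Tens_cat s s' t t' :
    tens_eq s s' -> tens_eq t t' -> tens_eq (s ++ t) (s' ++ t')
| Tens_comm s t : tens_eq (s ++ t) (t ++ s)
| Tens_zero m : tens_eq [:: (0, m)] [::]
| Tens_addl n n' m : tens_eq [:: (n + n', m)] [:: (n, m); (n', m)]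
| Tens_addr n m m' : tens_eq [:: (n, m + m')] [:: (n, m); (n, m')]
| Tens_scale (a : A) n m : tens_eq [:: (a *: n, m)] [:: (n, a *: m)].

Definition tens_rel (s t : seq (N * M)) : bool := `[< tens_eq s t >].

Lemma tens_rel_equiv : equiv_class_of tens_rel.
Proof.
split=> [s|s t|t s u]; first exact/asboolP/Tens_refl.
  by apply/asboolP/asboolP => /Tens_sym.
by move=> /asboolP st /asboolP tu; apply/asboolP/(Tens_trans st tu).
Qed.

Canonical tens_equiv := EquivRelPack tens_rel_equiv.
Canonical tens_encModRel := defaultEncModRel tens_rel.

Definition tensor : Type := {eq_quot tens_rel}.
HB.instance Definition _ := EqQuotient.on tensor.
HB.instance Definition _ := Choice.on tensor.

Definition tens_sum (s : seq (N * M)) : tensor := \pi_tensor s.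

Lemma tens_sumP s t : tens_sum s = tens_sum t <-> tens_eq s t.
Proof.
split=> [/eqP|st]; first by rewrite /tens_sum piE => /asboolP.
by apply/eqP; rewrite /tens_sum piE; apply/asboolP.
Qed.

End Tensor.

Section TensorMap.
Variables (A : comPzRingType) (M N N' : lmodType A) (f : {linear N -> N'}).

Definition tens_map1 (s : seq (N * M)) : seq (N' * M) :=
  [seq (f p.1, p.2) | p <- s].

Lemma tens_map1_eq s t : tens_eq s t -> tens_eq (tens_map1 s) (tens_map1 t).
Proof.
elim=> {s t} [s|s t _ st|s t u _ st _ tu|s s' t t' _ ss' _ tt'|s t|m|n n' m|
  n m m'|a n m]; rewrite /tens_map1 ?map_cat /= ?raddf0 ?raddfD ?linearZ /=.
- exact: Tens_refl.
- exact: Tens_sym.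
- exact: Tens_trans st tu.
- exact: Tens_cat.
- exact: Tens_comm.
- exact: Tens_zero.
- exact: Tens_addl.
- exact: Tens_addr.
- exact: Tens_scale.
Qed.

Definition tens_map (x : tensor N M) : tensor N' M :=
  tens_sum (tens_map1 (repr x)).

Lemma tens_mapE s : tens_map (tens_sum s) = tens_sum (tens_map1 s).
Proof. by apply/tens_sumP/tens_map1_eq/tens_sumP; rewrite /tens_sum reprK. Qed.

End TensorMap.

Definition flat_module (A : comPzRingType) (M : lmodType A) : Prop :=
  forall (N N' : lmodType A) (f : {linear N -> N'}),
    injective f -> injective (@tens_map A M N N' f).

(* B as an A-module through phi : A -> B. *)
Definition restrict (A B : comPzRingType) (phi : {rmorphism A -> B}) : Type :=
  B.

Section Restrict.
Variables (A B : comPzRingType) (phi : {rmorphism A -> B}).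

HB.instance Definition _ := GRing.Zmodule.copy (restrict phi) B.

Definition restrict_scale (a : A) (b : restrict phi) : restrict phi :=
  phi a * (b : B).

Lemma restrict_scaleA a b v :
  restrict_scale a (restrict_scale b v) = restrict_scale (a * b) v.
Proof. by rewrite /restrict_scale rmorphM mulrA. Qed.

Lemma restrict_scale1 : left_id 1 restrict_scale.
Proof. by move=> v; rewrite /restrict_scale rmorph1 mul1r. Qed.

Lemma restrict_scaleDr : right_distributive restrict_scale +%R.
Proof. by move=> a u v; apply: mulrDr. Qed.

Lemma restrict_scaleDl v : {morph restrict_scale^~ v : a b / a + b}.
Proof. by move=> a b; rewrite /restrict_scale rmorphD; apply: mulrDl. Qed.

HB.instance Definition _ := GRing.Zmodule_isLmodule.Build A (restrict phi)
  restrict_scaleA restrict_scale1 restrict_scaleDr restrict_scaleDl.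

End Restrict.

(* An affine scheme Spec B with a morphism to Spec A is given by the ring B
   with the ring morphism A -> B. *)
Record affine_scheme (A : comPzRingType) := AffineScheme {
  coord_ring : comPzRingType;
  structure_map : {rmorphism A -> coord_ring} }.

Arguments structure_map {A} _.

(* Flatness of the morphism Spec B -> Spec A. *)
Definition flat (A : comPzRingType) (Y : affine_scheme A) : Prop :=
  flat_module (restrict (structure_map Y)).

Definition isomorphic (A : comPzRingType) (X Y : affine_scheme A) : Prop :=
  exists f : {rmorphism coord_ring X -> coord_ring Y},
    bijective f /\ forall a, f (structure_map X a) = structure_map Y a.

(* The fiber over <t - a> of Spec B -> Spec k[t], viewed over Spec k: it is the
   spectrum of B (x)_{k[t]} k[t]/<t - a> = B/(t - a)B. *)
Definition fiber_ideal (k : comNzRingType) (Y : affine_scheme {poly k})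
    (a : k) : ideal (coord_ring Y) :=
  ideal_gen [set structure_map Y ('X - a%:P)].

Definition fiber (k : comNzRingType) (Y : affine_scheme {poly k}) (a : k) :
    affine_scheme k :=
  AffineScheme (quot_pi (fiber_ideal Y a) \o (structure_map Y \o polyC)).

Definition admits_flat_degeneration (k : comNzRingType)
    (Y Y0 : affine_scheme k) : Prop :=
  exists Yt : affine_scheme {poly k},
    [/\ flat Yt,
        forall a : k, a != 0 -> isomorphic (fiber Yt a) Y
      & isomorphic (fiber Yt 0) Y0].

(* 'I_n is {0, ..., n-1}: the index i : 'I_n stands for i + 1 in [n], and
   h i : 'I_n for the value h(i + 1) - 1. *)
Definition hessenberg n (h : 'I_n -> 'I_n) : Prop :=
  (forall i j : 'I_n, (i <= j)%N -> (h i <= h j)%N) /\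
  (forall i : 'I_n, (i <= h i)%N).

Definition minors (A : comNzRingType) p q k (M : 'M[A]_(p, q)) : set A :=
  [set m | exists (f : 'I_k -> 'I_p) (g : 'I_k -> 'I_q),
     [/\ {homo f : a b / (a < b)%N}, {homo g : a b / (a < b)%N}
       & m = \det (mxsub f g M)]].

Section MatrixHessenberg.
Variables (A : comNzRingType) (n : nat).

Definition Zmx : 'M[{mpoly A[n * n]}]_n := \matrix_(i, j) 'X_(mxvec_index i j).

Variables (x : 'M[A]_n) (h : 'I_n -> 'I_n).

(* The columns 0, ..., i of M. *)
Definition first_cols (B : Type) (M : 'M[B]_n) (i : 'I_n) : 'M[B]_(n, i.+1) :=
  colsub (widen_ord (ltn_ord i)) M.

(* [x v_1 ... x v_i  v_1 ... v_h(i)]; the j-th column of x Z is x v_j. *)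
Definition hess_mx (i : 'I_n) : 'M[{mpoly A[n * n]}]_(n, i.+1 + (h i).+1) :=
  row_mx (first_cols (map_mx (@mpolyC (n * n) A) x *m Zmx) i)
         (first_cols Zmx (h i)).

Definition hess_ideal_at (i : 'I_n) : ideal {mpoly A[n * n]} :=
  ideal_gen (if ((h i).+1 < n)%N then minors (h i).+2 (hess_mx i) else set0).

Definition hess_ideal : ideal {mpoly A[n * n]} := ideal_sum hess_ideal_at.

Definition hess_ideal_sat : ideal {mpoly A[n * n]} :=
  ideal_sat (\det Zmx) hess_ideal.

(* For A = C this is Y_{x,h} over Spec C; for A = C[t] it is Y_{x_t,h} with
   its morphism to Spec C[t]. *)
Definition hess_scheme : affine_scheme A :=
  AffineScheme (quot_pi hess_ideal_sat \o @mpolyC (n * n) A).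

End MatrixHessenberg.

(* E_{pq} with p and q counted from 1. *)
Definition matrix_unit (A : pzSemiRingType) n (p q : nat) : 'M[A]_n :=
  \matrix_(i, j) ((i.+1 == p) && (j.+1 == q))%:R.

Definition diag12 (A : pzSemiRingType) n (c1 c2 : A) : 'M[A]_n :=
  diag_mx (\row_i if val i == 0%N then c1 else c2).

Definition conjugate (A : comUnitRingType) n (x y : 'M[A]_n) : Prop :=
  exists2 g : 'M[A]_n, g \in unitmx & x = g *m y *m invmx g.

Definition minimal_sheet (k : fieldType) n (x : 'M[k]_n) : Prop :=
  (exists c1 c2 : k, c1 != c2 /\ conjugate x (diag12 n c1 c2)) \/
  (exists c : k, conjugate x (c%:M + matrix_unit k n n.-1 n)).

(* A relation rather than a function: for n = 2 the eigenvalues c1 and c2 of x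
   may be exchanged, which gives two sheet lines. *)
Definition sheet_line (k : fieldType) n (x : 'M[k]_n) (xt : 'M[{poly k}]_n) :
    Prop :=
  (exists c1 c2 : k, [/\ c1 != c2, conjugate x (diag12 n c1 c2)
     & xt = 'X *: map_mx polyC (diag12 n c1 c2) + matrix_unit _ n 1 n]) \/
  (exists c : k, conjugate x (c%:M + matrix_unit k n n.-1 n) /\
     xt = ('X * c%:P)%:M + matrix_unit _ n n.-1 n).

Definition minimal_nilpotent (k : fieldType) n (x : 'M[k]_n) : Prop :=
  conjugate x (matrix_unit k n 1 n).

(* Main.v *)
From mathcomp Require Import fingroup perm.
Require Import Defs.
From HB Require Import structures.
From mathcomp Require Import all_boot all_order all_algebra.
From mathcomp Require Import reals complex.
From mathcomp Require Import boolp classical_sets generic_quotient mpoly.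
From mathcomp Require Import ring zify.

Set Implicit Arguments.
Unset Strict Implicit.
Unset Printing Implicit Defensive.

Import Order.TTheory GRing.Theory.

Local Open Scope ring_scope.

(** Indices start at 0, as in the definitions. Up to adding a scalar matrix,
    which changes the matrices [x v_0 ... x v_i  v_0 ... v_h(i)] by invertible
    column operations, and up to conjugation by a constant matrix, which is the
    linear change of variables Z -> g Z, a sheet line is the rank one matrix
    tau E_(0,0) + E_(0,n-1), with tau = t (c1 - c2) in the semisimple case and
    tau = 0 in the other one. For this x one has x v_j = l_j e_0 with
    l_j = z_(n-1,j) + tau z_(0,j), and expanding the minors shows that the
    Hessenberg ideal is generated by the products l_j D, where D runs over the
    minors of Z on the columns 0, ..., h(j) and on rows different from the row
    0, for those j with h(j) < n - 1 ([rho_hess], [sigma_gen]).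

    Order the monomials by degree and then lexicographically, the entries of Z
    being compared from the bottom right corner: z_(n-1,n-1) is the largest
    variable and z_(0,0) the smallest one. Then l_j has the leading term
    z_(n-1,j), a minor has its diagonal as leading term, and the coefficients
    are 1 over every ring and for every tau. The heart of the proof is that the
    products l_j D form a Groebner basis. This rests on two relations
    ([straighten_last_row], [straighten_rows]): l_l l_j D, with l < j, can be
    expanded along the last columns of D, and the determinant of a matrix with
    a repeated column vanishes. They rewrite every element of the ideal as a
    combination of multiples of the generators in which a generator g is never
    multiplied by certain variables; for such restricted multiples the leading
    monomial determines the multiple ([admissible_unique]), so that no leading
    terms cancel ([straightened_lead]).

    There are two consequences, over an arbitrary domain A. First, A[z] is the
    direct sum of the ideal and of the A-span of the monomials that are not
    leading monomials ([lead_normal_form]); hence the quotient is a retract of a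
    free module, and it is flat over A ([flat_dual_basis]). Second, det Z has
    the leading term z_(0,0) ... z_(n-1,n-1), while the leading terms of the
    generators only involve entries strictly below the diagonal; hence det Z is
    a nonzerodivisor modulo the ideal ([gen_ideal_det]), which is therefore
    equal to its saturation.

    With A = C[t] this is the flatness of the family. Since the ideal is
    saturated both over C[t] and after every specialization t = a, the fiber
    over a is the Hessenberg scheme of the matrix x_a ([hess_scheme_fiber]).
    For a <> 0 this matrix is, up to a scalar matrix and a unit factor,
    conjugate to x, and for a = 0 it lies in the minimal nilpotent orbit. *)

(** * Ideals *)

Section IdealFacts.
Variable A : comPzRingType.
Implicit Types (I : ideal A) (G : set A).

Lemma ideal_Mr I a x : I x -> I (x * a).
Proof. by rewrite mulrC; apply: ideal_M. Qed.

Lemma ideal_N I x : I x -> I (- x).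
Proof. by rewrite -mulN1r; apply: ideal_M. Qed.

Lemma ideal_B I x y : I x -> I y -> I (x - y).
Proof. by move=> Ix Iy; apply: ideal_D => //; apply: ideal_N. Qed.

Lemma ideal_bigsum I (T : Type) (r : seq T) (P : pred T) F :
  (forall t, P t -> I (F t)) -> I (\sum_(t <- r | P t) F t).
Proof.
by move=> FI; elim/big_rec: _ => [|t x /FI Ft Ix]; [apply: ideal_0 | apply: ideal_D].
Qed.

Lemma mem_ideal_gen G x : G x -> ideal_gen G x.
Proof.
move=> Gx; exists [:: (1, x)]; last by rewrite big_seq1 mul1r.
by move=> p; rewrite inE => /eqP ->.
Qed.

Lemma ideal_gen_sub G I : (forall x, G x -> I x) -> forall x, ideal_gen G x -> I x.
Proof.
move=> GI _ [s sG ->]; rewrite big_seq; apply: ideal_bigsum => p /sG Gp.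
exact/ideal_M/GI.
Qed.

End IdealFacts.

(** * Leading monomials and normal forms *)

Section Leading.
Variables (R : nzRingType) (N : nat).
Implicit Types (f g : {mpoly R[N]}) (m : 'X_{1..N}).

Lemma mlead_eq f m :
  f@_m != 0 -> (forall m', f@_m' != 0 -> (m' <= m)%O) -> mlead f = m.
Proof.
move=> fm le_m; apply/eqP; rewrite eq_le msupp_le_mlead ?mcoeff_msupp // andbT.
by apply/le_m; rewrite mleadc_eq0; apply: contraNneq fm => ->; rewrite mcoeff0.
Qed.

Lemma mlead_cancel f g : mlead g = mlead f -> g@_(mlead g) = 1 ->
  f - f@_(mlead f) *: g = 0 \/ (mlead (f - f@_(mlead f) *: g) < mlead f)%O.
Proof.
move=> lgf lcg; set q := f - _; have [->|q0] := eqVneq q 0; first by left.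
right; rewrite lt_neqAle; apply/andP; split.
  apply: contra_neq q0 => lq; apply/eqP; rewrite -mleadc_eq0 lq /q.
  by rewrite mcoeffB mcoeffZ -[in g@__]lgf lcg mulr1 subrr.
apply: le_trans (mleadB_le _ _) _; rewrite leUx lexx /= -lgf.
exact: mleadZ_le.
Qed.

End Leading.

Section Span.
Variables (R : comNzRingType) (N : nat).
Implicit Types (f g : {mpoly R[N]}) (w m : 'X_{1..N}).

(** Restricting the monomials that may multiply each element of the family is
    what makes it possible to keep track of leading monomials. *)
Inductive mspan (T : Type) (G : T -> {mpoly R[N]})
    (P : 'X_{1..N} -> T -> Prop) : {mpoly R[N]} -> Prop :=
| Mspan0 : mspan G P 0
| MspanT c w t : P w t -> mspan G P (c *: ('X_[w] * G t))
| MspanD f g : mspan G P f -> mspan G P g -> mspan G P (f + g).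

Lemma mspan1 T (G : T -> {mpoly R[N]}) (P : _ -> T -> Prop) w t :
  P w t -> mspan G P ('X_[w] * G t).
Proof. by move=> Pwt; rewrite -[X in mspan _ _ X]scale1r; apply: MspanT. Qed.

Lemma mspanZ T (G : T -> {mpoly R[N]}) P c f :
  mspan G P f -> mspan G P (c *: f).
Proof.
elim=> {f} [|a w t Pwt|f g _ IHf _ IHg]; rewrite ?scaler0 ?scalerDr.
- exact: Mspan0.
- by rewrite scalerA; apply: MspanT.
- exact: MspanD.
Qed.

Lemma mspanN T (G : T -> {mpoly R[N]}) P f : mspan G P f -> mspan G P (- f).
Proof. by rewrite -scaleN1r; apply: mspanZ. Qed.

Lemma mspan_sign T (G : T -> {mpoly R[N]}) P e f :
  mspan G P f -> mspan G P ((-1) ^+ e * f).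
Proof.
by rewrite -signr_odd; case: (odd e); rewrite ?mulN1r ?mul1r //; apply: mspanN.
Qed.

Lemma mspan_sum T (G : T -> {mpoly R[N]}) P (I : Type) (r : seq I) (Q : pred I) F :
  (forall i, Q i -> mspan G P (F i)) -> mspan G P (\sum_(i <- r | Q i) F i).
Proof.
move=> FP; elim/big_rec: _ => [|i x /FP Fi Px]; [exact: Mspan0 | exact: MspanD].
Qed.

(** The form of transitivity used to compose two rewriting steps: q collects
    the factors by which a relation is multiplied before it is applied. *)
Lemma mspan_bind T T' (G : T -> {mpoly R[N]}) P
    (G' : T' -> {mpoly R[N]}) P' (q : {mpoly R[N]}) f :
  mspan G P f ->
  (forall w t, P w t -> mspan G' P' (q * ('X_[w] * G t))) -> mspan G' P' (q * f).
Proof.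
move=> fP sub; elim: fP => [|c w t /sub qwt|x y _ IHx _ IHy].
- by rewrite mulr0; apply: Mspan0.
- by rewrite -scalerAr; apply: mspanZ.
- by rewrite mulrDr; apply: MspanD.
Qed.

End Span.

(** A linear projection of the polynomial ring onto a complement of the ideal. *)
Definition has_normal_form (A : comNzRingType) N (I : ideal {mpoly A[N]}) : Prop :=
  exists NF : {mpoly A[N]} -> {mpoly A[N]},
  [/\ forall (c : A) f g, NF (c *: f + g) = c *: NF f + NF g,
      forall f, I (f - NF f) & forall f, I f -> NF f = 0].

(** Here J is the set of the leading monomials of the ideal, each of which is
    the leading monomial of a monic element: over a ring with non-invertible
    elements this is what makes division possible. *)
Section LeadIdeal.
Variables (R : idomainType) (N : nat) (I : ideal {mpoly R[N]}).
Variable J : 'X_{1..N} -> Prop.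
Hypothesis leadJ : forall f, I f -> f != 0 -> J (mlead f).
Hypothesis monicJ : forall m, J m ->
  exists g, [/\ I g, mlead g = m & g@_(mlead g) = 1].
Implicit Types f g r : {mpoly R[N]}.

Let normal f := forall m, f@_m != 0 -> ~ J m.

Let normal_exists f : exists r, I (f - r) /\ normal r.
Proof.
suff: forall m f, mlead f = m -> exists r, I (f - r) /\ normal r by apply.
apply: (@ltmwf N) => m IH {}f lf.
have small f' : f' = 0 \/ (mlead f' < m)%O -> exists r, I (f' - r) /\ normal r.
  case=> [->|lt]; last exact: IH lt f' erefl.
  exists 0; rewrite subr0; split; first exact: ideal_0.
  by move=> m'; rewrite mcoeff0 eqxx.
have [Jm|nJm] := pselect (J m).
  have [g [Ig lg cg]] := monicJ Jm.
  have [] := small (f - f@_m *: g).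
    by rewrite -lf; apply: mlead_cancel => //; rewrite lf.
  move=> r [Ir nr]; exists r; split=> //.
  have -> : f - r = f - f@_m *: g - r + f@_m *: g by rewrite addrAC subrK.
  by apply: ideal_D => //; rewrite -mul_mpolyC; apply: ideal_M.
have [] := small (f - f@_m *: 'X_[m]).
  by rewrite -lf; apply: mlead_cancel; rewrite ?mleadXm ?mcoeffX ?eqxx.
move=> r [Ir nr]; exists (r + f@_m *: 'X_[m]); split.
  by move: Ir; rewrite opprD addrA addrAC.
move=> m'; have [<- _ //|ne] := eqVneq m m'.
by rewrite mcoeffD mcoeffZ mcoeffX (negbTE ne) mulr0 addr0; apply: nr.
Qed.

Let normal_uniq r : I r -> normal r -> r = 0.
Proof.
move=> Ir nr; apply/eqP; apply: contraPT isT => r0 _.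
by apply: (nr (mlead r)); rewrite ?mleadc_eq0 //; apply: leadJ.
Qed.

(** The remainder of the division is unique, since a difference of two
    remainders would be an element of I whose leading monomial is outside J; the
    uniqueness makes it depend linearly on the dividend. *)
Lemma lead_normal_form : has_normal_form I.
Proof.
have [NF NFP] := choice normal_exists.
exists NF; split=> [a f g|f|f If]; last 2 first.
- by have [] := NFP f.
- apply: normal_uniq; last by have [] := NFP f.
  have [Ir _] := NFP f; rewrite -[NF f](subKr f).
  exact: ideal_B.
have [If nf] := NFP f; have [Ig ng] := NFP g; have [Ih nh] := NFP (a *: f + g).
apply/eqP; rewrite -subr_eq0; apply/eqP; apply: normal_uniq.
  have -> : NF (a *: f + g) - (a *: NF f + NF g) =
      a *: (f - NF f) + (g - NF g) - (a *: f + g - NF (a *: f + g)).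
    rewrite scalerBr; set u := a *: f; set v := a *: NF f; set w := NF _.
    by ring.
  apply: ideal_B => //; apply: ideal_D => //.
  by rewrite -mul_mpolyC; apply: ideal_M.
move=> m; rewrite mcoeffB mcoeffD mcoeffZ.
have [Jm|//] := pselect (J m).
have z r : normal r -> r@_m = 0.
  by move=> nr; apply/eqP; apply: contraPT Jm; apply: nr.
by rewrite !z // mulr0 addr0 subr0 eqxx.
Qed.

(** If u * f is in I then its leading monomial mlead u + mlead f is in J, so
    that mlead f is in J too and f can be reduced. *)
Lemma lead_nonzerodivisor (u f : {mpoly R[N]}) :
  u != 0 -> (forall m, J (mlead u + m)%MM -> J m) -> I (u * f) -> I f.
Proof.
move=> u0 uJ; suff: forall m f, mlead f = m -> I (u * f) -> I f by apply.
apply: (@ltmwf N) => m IH {}f lf Iuf.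
have [->|f0] := eqVneq f 0; first exact: ideal_0.
have Jm : J m by apply: uJ; rewrite -lf -mleadM //; apply: leadJ; rewrite ?mulf_neq0.
have [g [Ig lg cg]] := monicJ Jm; have Icg c : I (c *: g).
  by rewrite -mul_mpolyC; apply: ideal_M.
rewrite -(subrK (f@_(mlead f) *: g) f); apply: ideal_D => //.
have [-> |] := mlead_cancel (etrans lg (esym lf)) cg; first exact: ideal_0.
rewrite [X in (_ < X)%O -> _]lf => lt.
apply: IH lt _ erefl _; rewrite mulrBr; apply: ideal_B => //.
exact: ideal_M.
Qed.

End LeadIdeal.

(** * Straightening *)

(** An abstract criterion for a family of monic polynomials g to be a Groebner
    basis. To each g s is attached a set V s of variables, such that v * g s can
    be rewritten with smaller terms for each v in V s: terms with a smaller
    leading monomial or with the same one and an index of smaller rank. This is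
    the situation of a monomial ideal with linear quotients, V s being the set
    of the variables that generate the quotient by the preceding generators. *)
Section Straightening.
Variables (R : idomainType) (N : nat) (S : Type).
Variables (ok : S -> Prop) (g : S -> {mpoly R[N]}) (V : S -> 'I_N -> Prop).
Variable rk : S -> nat.
Implicit Types (s t : S) (w m : 'X_{1..N}) (f : {mpoly R[N]}).

Let lm s := mlead (g s).

Definition admissible w s := ok s /\ forall v, V s v -> w v = 0%N.

Hypothesis straight : forall s v, ok s -> V s v ->
  mspan g (fun w t => ok t /\
    (((w + lm t)%MM < (U_(v) + lm s)%MM)%O \/
     (w + lm t = U_(v) + lm s)%MM /\ (rk t < rk s)%N)) ('X_v * g s).

Hypothesis monic : forall s, ok s -> (g s)@_(lm s) = 1.

Hypothesis unique : forall w s w' s', admissible w s -> admissible w' s' ->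
  (w + lm s = w' + lm s')%MM -> 'X_[w] * g s = 'X_[w'] * g s'.

(** Induction on the leading monomial, then on the rank: a variable of V s that
    divides w is absorbed by the rewriting rule for v * g s. *)
Lemma straighten w s : ok s -> mspan g admissible ('X_[w] * g s).
Proof.
suff: forall m k w s, (w + lm s)%MM = m -> (rk s < k)%N -> ok s ->
    mspan g admissible ('X_[w] * g s) by move=> H; apply: (H _ (rk s).+1).
apply: (@ltmwf N) => m IHm; elim=> [//|k IHk] {}w {}s ms ks oks.
have [adm|nadm] := pselect (forall v, V s v -> w v = 0%N).
  by apply: mspan1; split.
have [v Vv wv] : exists2 v, V s v & w v != 0%N.
  apply: contrapT => H; apply: nadm => v Vv; apply/eqP.
  by apply: contrapT => /negP wv; apply: H; exists v.
have Uw : (U_(v) <= w)%MM by rewrite lep1mP.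
rewrite -(submK Uw) mpolyXD -mulrA; apply: (mspan_bind (straight oks Vv)) => w' t [okt lt].
have mE : m = (w - U_(v) + (U_(v) + lm s))%MM by rewrite addmA submK.
rewrite mulrA -mpolyXD; case: lt => [lt|[eqm lt]].
  by apply: (IHm _ _ (rk t).+1 _ _ erefl) => //; rewrite mE -addmA ltmc_add2r.
by apply: IHk; rewrite ?mE -?addmA ?eqm ?(leq_trans lt).
Qed.

Lemma straighten_ideal f :
  ideal_gen [set f | exists2 s, ok s & f = g s]%classic f -> mspan g admissible f.
Proof.
case=> r rG ->; rewrite big_seq; apply: mspan_sum => p /rG [s oks ->].
rewrite mulrC (mpolyE p.1) mulr_sumr; apply: mspan_sum => m _.
by rewrite -scalerAr mulrC; apply: mspanZ; apply: straighten.
Qed.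

(** By uniqueness the admissible multiples of the g s have pairwise distinct
    leading monomials (or coincide), so that no leading term cancels in a linear
    combination of them. *)
Lemma straightened_lead f : mspan g admissible f -> f != 0 ->
  exists w s, admissible w s /\ mlead f = (w + lm s)%MM.
Proof.
pose J m := exists w s, admissible w s /\ m = (w + lm s)%MM.
(* e m is the admissible multiple with leading monomial m; the coefficients of
   a combination of these multiples are stored as a polynomial c, with the same
   leading monomial as the combination E c. *)
have [e eE] : exists e : 'X_{1..N} -> {mpoly R[N]},
    forall w s, admissible w s -> e (w + lm s)%MM = 'X_[w] * g s.
  have H m : exists p, forall w s, admissible w s -> m = (w + lm s)%MM -> p = 'X_[w] * g s.
    have [[w [s [ws ->]]]|nJ] := pselect (J m).
      by exists ('X_[w] * g s) => w' s' ws' E; apply: unique.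
    by exists 0 => w s ws E; case: nJ; exists w, s.
  by have [e eP] := choice H; exists e => w s ws; apply: eP.
have e1 m : J m -> (e m)@_m = 1.
  case=> w [s [ws ->]]; rewrite eE // -[in X in _@_(X + _)](mleadXm R w) mleadcM.
  by rewrite mleadXm mcoeffX eqxx mul1r monic //; case: ws.
have le_e m m' : J m -> (e m)@_m' != 0 -> (m' <= m)%O.
  case=> w [s [ws ->]]; rewrite eE // -mcoeff_msupp => /msupp_le_mlead le.
  by apply: le_trans le _; apply: le_trans (mleadM_le _ _) _; rewrite mleadXm.
pose E (c : {mpoly R[N]}) := \sum_(m <- msupp c) c@_m *: e m.
have EE r c : uniq r -> {subset msupp c <= r} -> E c = \sum_(m <- r) c@_m *: e m.
  move=> ur sub; rewrite /E [RHS](bigID (mem (msupp c))) /= [X in _ + X]big1 ?addr0.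
    rewrite -[RHS]big_filter; apply: perm_big; apply: uniq_perm.
    - exact: msupp_uniq.
    - exact: filter_uniq.
    - by move=> m; rewrite mem_filter; case: (boolP (_ \in _)) => // /sub ->.
  by move=> m /memN_msupp_eq0 ->; rewrite scale0r.
move=> fs; have [c [cJ ->]] : exists c, (forall m, m \in msupp c -> J m) /\ f = E c.
  elim: fs => [|a w s ws|x y _ [c [cJ ->]] _ [d [dJ ->]]].
  - by exists 0; rewrite /E msupp0 big_nil; split.
  - exists (a *: 'X_[w + lm s]); split.
      by move=> m /msuppZ_le; rewrite msuppX inE => /eqP ->; exists w, s.
    rewrite (EE [:: (w + lm s)%MM]) //; last by move=> m /msuppZ_le; rewrite msuppX.
    by rewrite big_seq1 mcoeffZ mcoeffX eqxx mulr1 eE.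
  - exists (c + d); split=> [m /msuppD_le|].
      by rewrite mem_cat => /orP[/cJ|/dJ].
    pose r := undup (msupp c ++ msupp d); have ur : uniq r by apply: undup_uniq.
    rewrite !(EE r) //.
    + by rewrite -big_split; apply: eq_bigr => m _; rewrite mcoeffD scalerDl.
    + by move=> m /msuppD_le; rewrite mem_undup.
    + by move=> m; rewrite mem_undup mem_cat => ->; rewrite orbT.
    + by move=> m; rewrite mem_undup mem_cat => ->.
have [->|c0] := eqVneq c 0; first by rewrite /E msupp0 big_nil eqxx.
move=> _; have [w [s [ws lc]]] : J (mlead c) by apply/cJ/mlead_supp.
exists w, s; split=> //; rewrite -lc; apply: mlead_eq.
  rewrite /E (bigD1_seq (mlead c)) ?mlead_supp ?msupp_uniq //= mcoeffD mcoeffZ.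
  rewrite e1; last by exists w, s.
  rewrite mulr1 raddf_sum big_seq_cond big1 ?addr0 ?mleadc_eq0 // => m /andP[mc ne].
  rewrite /= mcoeffZ; apply/eqP; rewrite mulf_eq0; apply/orP; right.
  apply: contraNT ne => /(le_e _ _ (cJ _ mc)) le.
  by rewrite eq_le le msupp_le_mlead.
move=> m; rewrite /E raddf_sum => nz; apply: contraNT nz; rewrite -ltNge => lt.
rewrite big_seq big1 // => m' m'c; rewrite /= mcoeffZ; apply/eqP; rewrite mulf_eq0.
apply/orP; right.
apply: contraLR lt => /(le_e _ _ (cJ _ m'c)) le; rewrite -leNgt.
exact: le_trans le (msupp_le_mlead m'c).
Qed.

End Straightening.

(** * Minors and the diagonal order *)

Definition increasing_rows (k : nat) (a : nat -> nat) : Prop :=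
  forall p q, (p < q < k)%N -> (a p < a q)%N.

(** The order on monomials compares exponents from the variable 0 on, so that
    the variable 0 is the largest one: the entries of Z are numbered from the
    bottom right corner. Row sets are functions a : nat -> nat, of
    which the values at 0, ..., k - 1 matter: removing the row p is then the
    composition with bump p. *)
Section DiagonalOrder.
Variables (N n : nat) (var : nat -> nat -> 'I_N).
Hypothesis var_lt : forall i j i' j',
  (i < n)%N -> (j < n)%N -> (i' < n)%N -> (j' < n)%N ->
  (i' < i)%N || (i' == i) && (j' < j)%N -> (var i j < var i' j')%N.

Lemma var_inj i j i' j' : (i < n)%N -> (j < n)%N -> (i' < n)%N -> (j' < n)%N ->
  var i j = var i' j' -> i = i' /\ j = j'.
Proof.
move=> i_n j_n i'_n j'_n E.
have nlt x y x' y' : (x < n)%N -> (y < n)%N -> (x' < n)%N -> (y' < n)%N ->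
    var x y = var x' y' -> (x' < x)%N || (x' == x) && (y' < y)%N = false.
  move=> xn yn x'n y'n e; apply/negP => /(var_lt xn yn x'n y'n).
  by rewrite e ltnn.
have := nlt _ _ _ _ i_n j_n i'_n j'_n E; have := nlt _ _ _ _ i'_n j'_n i_n j_n (esym E).
by lia.
Qed.

Lemma var_eq i j i' j' : (i < n)%N -> (j < n)%N -> (i' < n)%N -> (j' < n)%N ->
  (var i j == var i' j') = (i == i') && (j == j').
Proof.
move=> *; apply/eqP/andP => [/var_inj[]// -> ->|[/eqP-> /eqP->]//].
by rewrite !eqxx.
Qed.

Definition mon k (a phi : nat -> nat) : 'X_{1..N} :=
  (\sum_(p < k) U_(var (a p) (phi p)))%MM.

Lemma monE k a phi v : mon k a phi v = (\sum_(p < k) (var (a p) (phi p) == v))%N.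
Proof. by rewrite /mon mnm_sumE; apply: eq_bigr => p _; rewrite mnm1E. Qed.

Lemma eq_mon k a phi b psi : (forall p, (p < k)%N -> a p = b p /\ phi p = psi p) ->
  mon k a phi = mon k b psi.
Proof. by move=> E; apply: eq_bigr => p _; have [-> ->] := E p (ltn_ord p). Qed.

(** The last row in which the two products differ contains the largest variable
    in which their exponents differ. *)
Lemma mon_lt k a phi psi p0 :
  increasing_rows k a ->
  (forall p, (p < k)%N -> [/\ (a p < n)%N, (phi p < n)%N & (psi p < n)%N]) ->
  (p0 < k)%N -> (forall p, (p0 < p < k)%N -> phi p = psi p) ->
  (phi p0 < psi p0)%N -> (mon k a phi < mon k a psi)%O.
Proof.
move=> inc bnd p0k eqp ltp.
have [an phn psn] := bnd _ p0k.
have small p : (p < p0)%N -> forall j, (j < n)%N -> (var (a p0) (psi p0) < var (a p) j)%N.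
  move=> pp0 j jn; have [apn _ _] := bnd _ (ltn_trans pp0 p0k).
  by apply: var_lt => //; rewrite inc ?pp0.
apply/ltmcP.
  by rewrite /mon !mdeg_sum; apply: eq_bigr => p _; rewrite !mdeg1.
exists (var (a p0) (psi p0)) => [v lt_v|].
  rewrite !monE; apply: eq_bigr => -[p /= pk] _.
  have [_ ? ?] := bnd _ pk; case: (ltngtP p p0) => [pp0|pp0|->].
  - have nev j : (j < n)%N -> (var (a p) j == v) = false.
      by move=> jn; apply/eqP => E; have := small _ pp0 _ jn; rewrite E; lia.
    by rewrite !nev.
  - by rewrite eqp ?pp0.
  - have -> : (var (a p0) (psi p0) == v) = false by apply/eqP => E; rewrite E ltnn in lt_v.
    suff -> : (var (a p0) (phi p0) == v) = false by [].
    apply/eqP => E; have : (var (a p0) (psi p0) < var (a p0) (phi p0))%N.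
      by apply: var_lt => //; rewrite eqxx ltp orbT.
    by rewrite E ltnNge ltnW.
rewrite !monE (bigD1 (Ordinal p0k)) //= [X in (_ < X)%N](bigD1 (Ordinal p0k)) //= eqxx.
rewrite var_eq // eqxx /= (ltn_eqF ltp) add0n add1n ltnS.
apply: leq_sum => -[p pk] /=; rewrite -val_eqE /= => ne.
have [_ ? ?] := bnd _ pk; case: (ltngtP p p0) => [pp0|pp0|E].
- suff -> : (var (a p) (phi p) == var (a p0) (psi p0)) = false by [].
  by apply/eqP => E; have := small _ pp0 (phi p); rewrite E ltnn => H; apply: notF (H _).
- by rewrite eqp ?pp0.
- by rewrite E eqxx in ne.
Qed.

Lemma mon_bump k a phi (p : 'I_k.+1) : mon k.+1 a phi =
  (U_(var (a p) (phi p)) + mon k (a \o bump p) (phi \o bump p))%MM.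
Proof. by rewrite /mon (bigD1_ord p). Qed.

Section InitialMinors.
Variable R : comNzRingType.

Definition initial_minor k (a : nat -> nat) : {mpoly R[N]} :=
  \det (\matrix_(p < k, q < k) 'X_(var (a p) q)).

Lemma eq_minor k a b : (forall p, (p < k)%N -> a p = b p) ->
  initial_minor k a = initial_minor k b.
Proof. by move=> E; congr (\det _); apply/matrixP => p q; rewrite !mxE E. Qed.

(** For a permutation s <> 1 the last row p0 moved by s satisfies s p0 < p0, so
    that mon_lt compares the term of s with the diagonal term. *)
Lemma minor_lead k a : (k <= n)%N -> increasing_rows k a ->
  (forall p, (p < k)%N -> (a p < n)%N) ->
  mlead (initial_minor k a) = mon k a id /\ (initial_minor k a)@_(mon k a id) = 1.
Proof.
move=> kn inc an.
pose phi (s : 'S_k) p := oapp (fun i => val (s i)) 0%N (insub p).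
have phiE s (i : 'I_k) : phi s i = s i by rewrite /phi valK.
have expand : initial_minor k a = \sum_(s : 'S_k) (-1) ^+ s *: 'X_[mon k a (phi s)].
  apply: eq_bigr => s _; rewrite -mul_mpolyC rmorphXn rmorphN1 -mprodXE.
  by congr (_ * _); apply: eq_bigr => p _; rewrite !mxE phiE.
have phi1 : mon k a (phi 1%g) = mon k a id.
  by apply: eq_bigr => p _; rewrite phiE perm1.
have lt_phi s : s != 1%g -> (mon k a (phi s) < mon k a id)%O.
  move=> s1; have [i0 si0] : exists i, s i != i.
    apply/existsP; apply: contraNT s1 => /existsPn fix_s; apply/eqP/perm.permP => i.
    by rewrite perm1; apply/eqP/negbNE/fix_s.
  case: (@arg_maxnP _ i0 (fun i => s i != i) val si0) => p sp pmax.
  apply: (@mon_lt _ _ _ _ p) => //.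
  - move=> q qk; split; [exact: an|rewrite (phiE s (Ordinal qk))|exact: leq_trans kn].
    exact: leq_trans (ltn_ord _) kn.
  - move=> q /andP[pq qk]; rewrite (phiE s (Ordinal qk)); apply/eqP.
    change (s (Ordinal qk) == Ordinal qk); apply: contraLR pq => sq.
    by have := pmax _ sq; rewrite -leqNgt.
  - rewrite phiE; have [//|gt|eq] := ltngtP; last by move: sp; rewrite -val_eqE /= eq eqxx.
    have := pmax (s p); rewrite (inj_eq perm_inj) sp => /(_ isT).
    by rewrite /= leqNgt gt.
have coef : (initial_minor k a)@_(mon k a id) = 1.
  rewrite expand (bigD1 1%g) //= odd_perm1 scale1r mcoeffD phi1 mcoeffX eqxx.
  rewrite raddf_sum big1 ?addr0 // => s s1; rewrite /= mcoeffZ mcoeffX.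
  by rewrite (lt_eqF (lt_phi _ s1)) mulr0.
split=> //; apply: mlead_eq; first by rewrite coef oner_eq0.
move=> m; rewrite expand; apply: contraNT; rewrite -ltNge => lt.
rewrite raddf_sum big1 // => s _; rewrite /= mcoeffZ mcoeffX.
have [->|s1] := eqVneq s 1%g; first by rewrite phi1 (lt_eqF lt) mulr0.
by rewrite (lt_eqF (lt_trans (lt_phi _ s1) lt)) mulr0.
Qed.

(** Both the Laplace expansion of a minor along its last column, for c = k, and
    the relation between minors that is used to straighten, for c < k. *)
Lemma minor_expand k (a : nat -> nat) (c : nat) :
  \det (\matrix_(p < k.+1, q < k.+1) 'X_(var (a p) (if q == k :> nat then c else q))) =
  \sum_(p < k.+1) (-1) ^+ (p + k) * ('X_(var (a p) c) * initial_minor k (a \o bump p))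
  :> {mpoly R[N]}.
Proof.
rewrite (expand_det_col _ ord_max); apply: eq_bigr => p _.
rewrite mxE eqxx mulrCA; congr (_ * (_ * _)); congr (\det _).
by apply/matrixP => i j; rewrite !mxE lift_max (ltn_eqF (ltn_ord j)).
Qed.

Lemma minor_last_column k (a : nat -> nat) :
  initial_minor k.+1 a =
  \sum_(p < k.+1) (-1) ^+ (p + k) * ('X_(var (a p) k) * initial_minor k (a \o bump p)).
Proof.
rewrite -minor_expand; congr (\det _); apply/matrixP => p q; rewrite !mxE.
by case: eqP => [->|].
Qed.

Lemma minor_repeated_column k (a : nat -> nat) (c : nat) : (c < k)%N ->
  \sum_(p < k.+1) (-1) ^+ (p + k) * ('X_(var (a p) c) * initial_minor k (a \o bump p)) = 0.
Proof.
move=> ck; rewrite -minor_expand -det_tr.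
apply: (@determinant_alternate _ _ _ (Ordinal (ltnW ck : (c < k.+1)%N)) ord_max).
  by rewrite -val_eqE /= ltn_eqF.
by move=> p; rewrite !mxE /= eqxx ltn_eqF.
Qed.

End InitialMinors.

Implicit Types (a : nat -> nat) (c k : nat).

Definition positive_rows k (a : nat -> nat) : Prop :=
  increasing_rows k a /\ forall p, (p < k)%N -> (0 < a p < n)%N.

Lemma positive_rows_bump k a p : positive_rows k.+1 a -> positive_rows k (a \o bump p).
Proof.
case=> inc bnd; split=> [q r /andP[qr rk] | q qk] /=; last by apply: bnd; rewrite /bump; lia.
by apply: inc; rewrite /bump; lia.
Qed.

(** The columns of the p-th term in minor_expand: c in the row p, and the columns
    0, ..., k - 1 in order in the other rows. *)
Let col (c p q : nat) : nat := if q == p then c else unbump p q.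

Lemma mon_col k a c (p : 'I_k.+1) :
  (U_(var (a p) c) + mon k (a \o bump p) id)%MM = mon k.+1 a (col c p).
Proof.
rewrite (mon_bump _ _ p) /col eqxx; congr (_ + _)%MM; apply: eq_mon => q _ /=.
by rewrite eq_sym (negbTE (neq_bump _ _)) bumpK.
Qed.

Lemma mon_last_column k a (p : 'I_k.+1) : (k < n)%N -> positive_rows k.+1 a ->
  ((U_(var (a p) k) + mon k (a \o bump p) id)%MM <= mon k.+1 a id)%O.
Proof.
move=> kn [inc bnd]; rewrite mon_col le_eqVlt.
have [pk|pk] := eqVneq (p : nat) k.
  apply/orP; left; apply/eqP; apply: eq_mon => q qk; split=> //.
  by rewrite /col /unbump; case: eqP => /=; lia.
have {}pk : (p < k)%N by have := ltn_ord p; lia.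
apply/orP; right; apply: (mon_lt (p0 := k)) => //.
- by move=> q qk; have bq := bnd q qk; rewrite /col /unbump; case: eqP => /= ?; split; lia.
- by move=> q; lia.
- by rewrite /col /unbump; case: eqP => /=; lia.
Qed.

(** Among the terms of minor_expand for c < k, the two largest ones are p = c and
    p = c + 1, which have the same monomial. *)
Lemma mon_repeated_column k a c (p : 'I_k.+1) :
    (k < n)%N -> positive_rows k.+1 a -> (c < k)%N -> p != c :> nat ->
  let top := mon k.+1 a (col c c) in
  ((U_(var (a p) c) + mon k (a \o bump p) id)%MM < top)%O \/
  (U_(var (a p) c) + mon k (a \o bump p) id)%MM = top /\ p = c.+1 :> nat.
Proof.
move=> kn [inc bnd] ck pc top; rewrite mon_col /top.
have bnds x q : (q < k.+1)%N -> [/\ (a q < n)%N, (col c x q < n)%N & (col c c q < n)%N].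
  move=> qk; have bq := bnd q qk.
  by rewrite /col /unbump; split; do ?[case: eqP => /= ?]; lia.
have [pc'|pc'|pc'] := ltngtP (p : nat) c.+1.
- left; apply: (mon_lt inc (bnds p) (p0 := c)); first by lia.
  + by move=> q; rewrite /col /unbump; do ![case: eqP => /=]; lia.
  + by rewrite /col /unbump; do ![case: eqP => /=]; lia.
- left; apply: (mon_lt inc (bnds p) (p0 := p)) => //.
  + by move=> q; rewrite /col /unbump; do ![case: eqP => /=]; lia.
  + by rewrite /col /unbump; do ![case: eqP => /=]; lia.
- right; split=> //; apply: eq_mon => q qk; split=> //.
  by rewrite /col /unbump; do ![case: eqP => /=]; lia.
Qed.

(** * The generators and their straightening relations *)

Section Generators.
Variable R : idomainType.
Local Notation minor := (initial_minor R).

(** Repeated expansion along the last column; no leading monomial exceeds the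
    one of the minor that is expanded. *)
Lemma minor_truncate k k' a : (k <= k')%N -> (k' <= n)%N -> positive_rows k' a ->
  mspan (minor k) (fun w b => positive_rows k b /\
    ((w + mon k b id)%MM <= mon k' a id)%O) (minor k' a).
Proof.
have base k0 b : positive_rows k0 b -> mspan (minor k0) (fun w b' =>
    positive_rows k0 b' /\ ((w + mon k0 b' id)%MM <= mon k0 b id)%O) (minor k0 b).
  by move=> pb; rewrite -[minor _ _]mul1r -mpolyX0; apply: mspan1; rewrite add0m.
elim: k' a => [|k' IH] a; rewrite leq_eqVlt => /orP[/eqP->|] //; try by move=> _; apply: base.
rewrite ltnS => kk' k'n pa; rewrite minor_last_column; apply: mspan_sum => p _.
have pb := positive_rows_bump p pa.
apply/mspan_sign/(mspan_bind (IH _ kk' (ltnW k'n) pb)) => w b [posb le].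
rewrite mulrA -mpolyXD; apply: mspan1; split=> //.
by apply: le_trans (mon_last_column p k'n pa); rewrite -addmA lemc_add2r.
Qed.

Variables (k : nat -> nat) (tau : R).
Hypothesis n_gt1 : (1 < n)%N.
Hypothesis k_mono : forall i j, (i <= j < n)%N -> (k i <= k j)%N.
Hypothesis k_gt : forall j, (j < n)%N -> (j < k j <= n)%N.

(** The linear form l_j of the relation x v_j = l_j e_0. *)
Definition ell j : {mpoly R[N]} := 'X_(var n.-1 j) + tau *: 'X_(var 0 j).

(** In an index s = (j, a), the rows a of the minor are taken on the k j first
    columns; k j stands for the number h(j) + 1 of columns v_0, ..., v_h(j). *)
Definition gen (s : nat * (nat -> nat)) := ell s.1 * minor (k s.1) s.2.

Definition gen_index (s : nat * (nat -> nat)) : Prop :=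
  [/\ (s.1 < n)%N, (k s.1 < n)%N & positive_rows (k s.1) s.2].

Definition gen_lm (s : nat * (nat -> nat)) : 'X_{1..N} :=
  (U_(var n.-1 s.1) + mon (k s.1) s.2 id)%MM.

Lemma last_row_gt_first j : (j < n)%N -> (U_(var 0 j)%MM < U_(var n.-1 j)%MM)%O.
Proof.
move=> jn; have lt : (var n.-1 j < var 0 j)%N by apply: var_lt => //; lia.
apply/ltmcP; first by rewrite !mdeg1.
exists (var n.-1 j) => [v lt_v|].
  rewrite !mnm1E; case: eqP => [E|_]; first by rewrite -E in lt_v; lia.
  by case: eqP => [E|//]; rewrite -E ltnn in lt_v.
by rewrite !mnm1E eqxx; case: eqP => // E; rewrite E ltnn in lt.
Qed.

Lemma ell_lead j : (j < n)%N ->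
  mlead (ell j) = U_(var n.-1 j)%MM /\ (ell j)@_(U_(var n.-1 j)) = 1.
Proof.
move=> jn; have lt := last_row_gt_first jn.
have coef : (ell j)@_(U_(var n.-1 j)) = 1.
  by rewrite mcoeffD mcoeffZ !mcoeffX eqxx (lt_eqF lt) mulr0 addr0.
split=> //; rewrite mleadDl mleadXm //.
by apply: le_lt_trans (mleadZ_le _ _) _; rewrite mleadXm.
Qed.

Lemma gen_lead s : gen_index s -> mlead (gen s) = gen_lm s /\ (gen s)@_(gen_lm s) = 1.
Proof.
case: s => j a [/= jn kn [inc bnd]].
have [le ce] := ell_lead jn.
have [lm cm] := minor_lead R (ltnW kn) inc (fun p pk => (andP (bnd p pk)).2).
have cE : mleadc (ell j) * mleadc (minor (k j) a) = 1.
  by rewrite le ce lm cm mulr1.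
rewrite /gen /gen_lm /= -le -lm; split; last by rewrite mleadcM.
by rewrite mleadM_proper // cE oner_eq0.
Qed.

(** The variables v for which v * gen s can be straightened: the entries of the
    last row in the columns l < j, and the entries z_(b,c) such that b > 0 can
    replace the row a c, b lying strictly between a (c - 1) and a c. *)
Definition gen_avoid (s : nat * (nat -> nat)) (v : 'I_N) : Prop :=
  (exists2 l, (l < s.1)%N & v = var n.-1 l) \/
  (exists b c, [/\ (c < k s.1)%N, (0 < b < s.2 c)%N,
     forall q, (q < c)%N -> (s.2 q < b)%N & v = var b c]).

(** The lexicographic order on (j, sum of the rows), encoded in nat: the sum is at
    most n * n. *)
Definition gen_rank (s : nat * (nat -> nat)) : nat :=
  (s.1 * (n * n).+1 + \sum_(p < k s.1) s.2 p)%N.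

Definition gen_below s v w t : Prop := gen_index t /\
  (((w + mlead (gen t))%MM < (U_(v) + mlead (gen s))%MM)%O \/
   (w + mlead (gen t) = U_(v) + mlead (gen s))%MM /\ (gen_rank t < gen_rank s)%N).

(** Since l_l = z_(n-1,l) + tau z_(0,l), the term z_(n-1,l) l_j D is equal to
    l_j (l_l D) up to a smaller term, and D is a combination of minors of the
    size k l <= k j: this gives multiples of the generators of index l < j. *)
Lemma straighten_last_row j a l : gen_index (j, a) -> (l < j)%N ->
  mspan gen (gen_below (j, a) (var n.-1 l)) ('X_(var n.-1 l) * gen (j, a)).
Proof.
move=> oks lj; have [/= jn kn pa] := oks; have [ls _] := gen_lead oks.
have ln := ltn_trans lj jn.
have -> : 'X_(var n.-1 l) * gen (j, a) = - tau *: ('X_(var 0 l) * gen (j, a)) +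
    (ell j * ell l) * minor (k j) a.
  by rewrite /gen /= /ell scaleNr -!mul_mpolyC; ring.
apply: MspanD.
  by apply: MspanT; split=> //; left; rewrite ltmc_add2l last_row_gt_first.
have kl : (k l <= k j)%N by apply: k_mono; lia.
apply: mspan_bind (minor_truncate kl (ltnW kn) pa) _ => w b [pb le].
have okt : gen_index (l, b) by split=> //; apply: leq_ltn_trans kl kn.
have lt_rk : (gen_rank (l, b) < gen_rank (j, a))%N.
  have le1 : (\sum_(p < k l) b p <= n * n)%N.
    apply: (@leq_trans (\sum_(p < k l) n)).
      by apply: leq_sum => p _; case: pb => _ /(_ p (ltn_ord p)); lia.
    by rewrite sum_nat_const card_ord leq_mul2r (ltnW (leq_ltn_trans kl kn)) orbT.
  apply: (@leq_trans (l.+1 * (n * n).+1)).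
    by rewrite /gen_rank /= mulSn addnC ltn_add2r ltnS.
  by apply: leq_trans (leq_addr _ _); rewrite leq_mul2r lj orbT.
have [lt _] := gen_lead okt.
have -> : ell j * ell l * ('X_[w] * minor (k l) b) = 'X_[U_(var n.-1 j) + w] * gen (l, b)
    + tau *: ('X_[U_(var 0 j) + w] * gen (l, b)).
  by rewrite /gen /= /ell !mpolyXD -!mul_mpolyC; ring.
have le' : ((U_(var n.-1 j) + w + gen_lm (l, b))%MM <= (U_(var n.-1 l) + gen_lm (j, a))%MM)%O.
  rewrite /gen_lm /= [X in (X <= _)%O](_ : _ =
    (U_(var n.-1 l) + (U_(var n.-1 j) + (w + mon (k l) b id)))%MM).
    by rewrite !lemc_add2r.
  by apply/mnmP => v; rewrite !mnmDE; lia.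
apply: MspanD; [apply: mspan1 | apply: MspanT]; split=> //; rewrite lt ls.
  by move: le'; rewrite le_eqVlt => /orP[/eqP ->|]; [right|left].
by left; apply: lt_le_trans le'; rewrite !ltmc_add2l last_row_gt_first.
Qed.

(** The minor relation for the rows a and b together, with the column c
    repeated. Its two terms with the largest monomial are z_(b,c) D and the one in
    which b replaces a c, which has a smaller sum of rows. *)
Lemma straighten_rows j a b c : gen_index (j, a) -> (c < k j)%N -> (0 < b < a c)%N ->
  (forall q, (q < c)%N -> (a q < b)%N) ->
  mspan gen (gen_below (j, a) (var b c)) ('X_(var b c) * gen (j, a)).
Proof.
move=> oks ck bac ltb; have [/= jn kn pa] := oks; have [ls _] := gen_lead oks.
(* C enumerates the rows a together with b, which gets the position c. *)
pose C q := if (q < c)%N then a q else if q == c then b else a q.-1.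
have [inc bnd] := pa.
have pC : positive_rows (k j).+1 C.
  split=> [p q /andP[pq qk]|p pk]; rewrite /C.
    case: (ltngtP p c) => pc; case: (ltngtP q c) => qc; try lia.
    - by apply: inc; lia.
    - by apply: inc; lia.
    - exact: ltb.
    - by apply: inc; lia.
    - have [->|ne] := eqVneq q.-1 c; first by lia.
      by have := inc c q.-1; lia.
  case: (ltngtP p c) => pc; [exact/bnd/ltn_trans/ck | by apply: bnd; lia |].
  by have := bnd c ck; lia.
have CE q : C (bump c q) = a q.
  rewrite /C; have [cq|cq] := leqP c q.
    by rewrite (_ : bump c q = q.+1) /=; [case: ltngtP; lia | rewrite /bump cq].
  by rewrite (_ : bump c q = q) /=; [rewrite cq | rewrite /bump leqNgt cq].
pose c' : 'I_(k j).+1 := Ordinal (leqW ck).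
have Cc : C c = b by rewrite /C ltnn eqxx.
have top : (U_(var b c) + mon (k j) a id)%MM = mon (k j).+1 C (col c c).
  rewrite -[c in RHS]/(c' : nat) -(mon_col _ _ c') /= Cc.
  by congr (_ + _)%MM; apply: eq_mon => q _ /=; rewrite CE.
have /eqP := minor_repeated_column R C ck.
rewrite (bigD1 c') //= Cc.
have -> : minor (k j) (C \o bump c) = minor (k j) a.
  by apply: eq_minor => q _ /=; rewrite CE.
rewrite addr_eq0 => /eqP E.
have -> : 'X_(var b c) * gen (j, a) = - ((-1) ^+ (c + k j) * (ell j *
    \sum_(p < (k j).+1 | p != c')
       (-1) ^+ (p + k j) * ('X_(var (C p) c) * minor (k j) (C \o bump p)))).
  rewrite -mulrN -mulrN -E /gen /=; set e := (-1) ^+ _.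
  have ee : e * e = 1 by rewrite -exprD addnn -signr_odd odd_double.
  by rewrite -[LHS]mul1r -ee; ring.
apply/mspanN/mspan_sign; rewrite mulr_sumr; apply: mspan_sum => p; rewrite -val_eqE /= => pc.
rewrite mulrCA; apply: mspan_sign.
rewrite mulrCA -[ell j * _]/(gen (j, C \o bump p)); apply: mspan1.
have okt : gen_index (j, C \o bump p) by split=> //; apply: positive_rows_bump.
split=> //; have [lt _] := gen_lead okt; rewrite lt ls /gen_lm /=.
have shift u v : (u + (U_(var n.-1 j) + v) = U_(var n.-1 j) + (u + v) :> 'X_{1..N})%MM.
  by apply/mnmP => x; rewrite !mnmDE; lia.
rewrite !shift top.
have [lt'|[eq' pE]] := mon_repeated_column kn pC ck pc; first by left; rewrite ltmc_add2r.
right; split; first by rewrite eq'.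
rewrite /gen_rank /= ltn_add2l.
have S (q : 'I_(k j).+1) : (\sum_(i < (k j).+1) C i = C q + \sum_(i < k j) C (bump q i))%N.
  by rewrite (bigD1_ord q).
have := S c'; rewrite (S p) /= pE Cc; under [X in (_ = _ + X)%N -> _]eq_bigr do rewrite CE.
have -> : C c.+1 = a c by rewrite /C ltnNge leqnSn gtn_eqF.
lia.
Qed.

Lemma gen_straight s v : gen_index s -> gen_avoid s v -> mspan gen (gen_below s v) ('X_v * gen s).
Proof.
case: s => j a oks [[l lj ->]|[b [c [ck bac ltb ->]]]].
  exact: straighten_last_row.
exact: straighten_rows.
Qed.

Local Notation admissible := (admissible gen_index gen_avoid).
Implicit Types (s : nat * (nat -> nat)).

Lemma mon_exponent h a r c : (h <= n)%N -> (forall p, (p < h)%N -> (a p < n)%N) ->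
  (r < n)%N -> (c < n)%N ->
  mon h a id (var r c) = ((c < h)%N && (a c == r) : nat).
Proof.
move=> hn an rn cn; rewrite monE.
have E (p : 'I_h) : (var (a p) p == var r c) = (p == c :> nat) && (a c == r).
  rewrite var_eq ?an ?(leq_trans (ltn_ord p)) //.
  by rewrite andbC; case: eqP => // ->.
have [ch|ch] /= := ltnP c h.
  rewrite (bigD1 (Ordinal ch)) //= (E (Ordinal ch)) /= eqxx big1 ?addn0 // => p.
  by rewrite -val_eqE /= => pc; rewrite E (negbTE pc).
by rewrite big1 // => p _; rewrite /= E ltn_eqF // (leq_trans (ltn_ord p)).
Qed.

Lemma lead_exponent s r c : gen_index s -> (r < n)%N -> (c < n)%N ->
  gen_lm s (var r c) =
  ((r == n.-1) && (c == s.1) + ((c < k s.1)%N && (s.2 c == r)))%N.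
Proof.
case: s => j a [/= jn kn [inc bnd]] rn cn.
rewrite /gen_lm mnmDE mnm1E var_eq //; last by lia.
rewrite mon_exponent //; [|exact: ltnW|by move=> p /bnd /andP[]].
by rewrite /= eq_sym [j == c]eq_sym.
Qed.

(** If s'.1 < s.1, the variable in the last row and the column s'.1 divides the
    right-hand side, while w and the leading monomial of gen s avoid it. *)
Lemma admissible_first_le w s w' s' : admissible w s -> admissible w' s' ->
  (w + gen_lm s = w' + gen_lm s')%MM -> (s.1 <= s'.1)%N.
Proof.
move=> [oks ws] [oks' _] E; rewrite leqNgt; apply/negP => lt.
have n1 : (n.-1 < n)%N by lia.
have jn : (s'.1 < n)%N by case: oks'.
have := congr1 (fun m : 'X_{1..N} => m (var n.-1 s'.1)) E.
rewrite /= (mnmDE _ w) (mnmDE _ w') !lead_exponent // ws; last by left; exists s'.1.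
rewrite !eqxx (ltn_eqF lt) /= => H.
have {H} : s.2 s'.1 = n.-1 by apply/eqP; move: H; case: eqP; lia.
case: oks => sn kn [inc bnd]; have := k_gt sn; have := inc s'.1 s.1; have := bnd s.1.
by lia.
Qed.

(** If b c < a c, the variable in the row b c and the column c divides the
    right-hand side, while w and the leading monomial of gen (j, a) avoid it. *)
Lemma admissible_rows_le w j a w' b c : admissible w (j, a) -> admissible w' (j, b) ->
  (w + gen_lm (j, a) = w' + gen_lm (j, b))%MM -> (c < k j)%N ->
  (forall q, (q < c)%N -> a q = b q) -> (a c <= b c)%N.
Proof.
move=> [oka wa] [okb _] E ck ab; rewrite leqNgt; apply/negP => lt.
have [/= jn kn [inc bnd]] := okb; have bc := bnd _ ck.
have bn : (b c < n)%N by lia.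
have cn := ltn_trans ck kn.
have := congr1 (fun m : 'X_{1..N} => m (var (b c) c)) E.
rewrite /= (mnmDE _ w) (mnmDE _ w') !lead_exponent //= ck eqxx (gtn_eqF lt) wa; first by lia.
right; exists (b c), c; split=> //=; first by rewrite lt; lia.
by move=> q qc; rewrite ab // inc // qc.
Qed.

Lemma admissible_unique w s w' s' : admissible w s -> admissible w' s' ->
  (w + mlead (gen s) = w' + mlead (gen s'))%MM -> 'X_[w] * gen s = 'X_[w'] * gen s'.
Proof.
move=> ws ws' E; have [[oks _] [oks' _]] := (ws, ws').
have [ls _] := gen_lead oks.
have [ls' _] := gen_lead oks'.
rewrite {}ls {}ls' in E.
have jj : s.1 = s'.1.
  apply/eqP; rewrite eqn_leq (admissible_first_le ws ws') //.
  by rewrite (admissible_first_le ws' ws).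
case: s s' jj ws ws' E oks oks' => [j a] [_ b] /= <- ws ws' E oks oks'.
have ab c : (c < k j)%N -> a c = b c.
  elim/ltn_ind: c => c IH ck; have eqab q : (q < c)%N -> a q = b q.
    by move=> qc; apply: IH => //; apply: ltn_trans ck.
  apply/eqP; rewrite eqn_leq (admissible_rows_le ws ws') //.
  by rewrite (admissible_rows_le ws' ws) // => q /eqab.
have lE : gen_lm (j, a) = gen_lm (j, b).
  by congr (_ + _)%MM; apply: eq_mon => p /ab.
by rewrite lE in E; rewrite (addIm E) /gen /= (eq_minor R ab).
Qed.

Definition gen_ideal : ideal {mpoly R[N]} :=
  ideal_gen [set f | exists2 s, gen_index s & f = gen s]%classic.

Let J m := exists w s, admissible w s /\ m = (w + mlead (gen s))%MM.

Let lead_in_J f : gen_ideal f -> f != 0 -> J (mlead f).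
Proof.
have mono s : gen_index s -> (gen s)@_(mlead (gen s)) = 1.
  by move=> oks; have [-> ->] := gen_lead oks.
move=> If f0; apply: (straightened_lead mono admissible_unique _ f0).
exact: straighten_ideal gen_straight _ If.
Qed.

Let J_has_monic m : J m ->
  exists g, [/\ gen_ideal g, mlead g = m & g@_(mlead g) = 1].
Proof.
case=> w [s [[oks _] ->]]; have [ls cs] := gen_lead oks.
exists ('X_[w] * gen s).
have E : mlead ('X_[w] * gen s) = (w + mlead (gen s))%MM.
  by rewrite mleadM_proper mleadXm // mcoeffX eqxx mul1r ls cs oner_eq0.
split=> //; first by apply/ideal_M/mem_ideal_gen; exists s.
by rewrite E -[X in _@_(X + _)](mleadXm R) mleadcM mleadXm mcoeffX eqxx mul1r ls.
Qed.

Lemma gen_ideal_normal_form : has_normal_form gen_ideal.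
Proof. exact: lead_normal_form lead_in_J J_has_monic. Qed.

(** The leading monomials of the generators have no entry on the diagonal:
    a c > c because the rows a are increasing and positive, and in the row n - 1
    the column j satisfies j < k j < n. So the diagonal, if it divides an
    admissible multiple of a leading monomial, divides the multiplier. *)
Lemma gen_ideal_det (f : {mpoly R[N]}) :
  gen_ideal (minor n id * f) -> gen_ideal f.
Proof.
have [ld cd] : mlead (minor n id) = mon n id id /\ (minor n id)@_(mon n id id) = 1.
  by apply: minor_lead => // p q /andP[].
have d0 : minor n id != 0.
  by rewrite -mleadc_eq0 ld cd oner_eq0.
apply: lead_nonzerodivisor lead_in_J J_has_monic _ _ d0 _ => m [w [s [[oks ws]]]].
have [-> _] := gen_lead oks; rewrite ld => E.
have le : (mon n id id <= w)%MM.
  apply/mnm_lepP => v; rewrite monE.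
  have [/existsP[i /eqP vE]|/existsPn nv] := boolP [exists i : 'I_n, v == var i i].
    have i_n := ltn_ord i; have := congr1 (fun m : 'X_{1..N} => m v) E.
    rewrite vE /= (mnmDE _ w) (mnmDE _ _ m) lead_exponent // monE.
    have [jn kn [inc bnd]] := oks; have kj := k_gt jn.
    have -> : ((i == n.-1 :> nat) && (i == s.1 :> nat)) = false by apply/negP; lia.
    have -> : (i < k s.1)%N && (s.2 i == i) = false.
      apply/negP => /andP[ik /eqP aE]; suff : forall q, (q < k s.1)%N -> (q < s.2 q)%N.
        by move=> /(_ _ ik); rewrite aE ltnn.
      elim=> [|q IH] qk; first by have := bnd 0%N qk; lia.
      by have := inc q q.+1; have := IH (ltnW qk); lia.
    by rewrite /= !addn0 => <-; apply: leq_addr.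
  by rewrite big1 // => i _; rewrite eq_sym (negbTE (nv i)).
exists (w - mon n id id)%MM, s; split.
  by split=> // v /ws; rewrite mnmBE => ->.
have [-> _] := gen_lead oks.
apply: (@addmI _ (mon n id id)); rewrite E addmA; congr (_ + _)%MM.
by rewrite addmC submK.
Qed.

End Generators.

End DiagonalOrder.

(** * Ideals of minors *)

Section MinorIdeal.
Variable A : comNzRingType.
Implicit Types k p q : nat.

Lemma rows_sort k p (f : 'I_k -> 'I_p) : injective f ->
  exists s : 'S_k, {homo f \o s : i j / (i < j)%N}.
Proof.
move=> f_inj; pose le := relpre (@nat_of_ord p) leq.
have le_total : total le by move=> i j; apply: leq_total.
pose t := sort_tuple le [tuple f i | i < k].
have ut : uniq t by rewrite sort_uniq /= map_inj_uniq ?enum_uniq.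
have /tuple_permP[s tE] : perm_eq (t : seq _) [tuple f i | i < k] by rewrite perm_sort.
exists s => i j ij.
have fE l : f (s l) = tnth t l.
  have -> : t = [tuple tnth [tuple f i | i < k] (s i) | i < k].
    by apply: val_inj; rewrite /= -tE.
  by rewrite !tnth_mktuple.
rewrite /= !fE ltn_neqAle; apply/andP; split.
  apply/negP => /eqP/val_inj/(tuple_uniqP _ ut) E.
  by move: ij; rewrite E ltnn.
have := sort_sorted le_total [tuple f i | i < k].
rewrite !(tnth_nth (f i)) => /(sorted_leq_nth _ _ (f i)); apply.
- by move=> x y z; apply: leq_trans.
- by move=> x; apply: leqnn.
- by rewrite inE size_tuple.
- by rewrite inE size_tuple.
- exact: ltnW.
Qed.

Lemma minors_tr k p q (M : 'M[A]_(p, q)) m : minors k M m -> minors k M^T m.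
Proof. by case=> f [g [fh gh ->]]; exists g, f; split=> //; rewrite -trmx_mxsub det_tr. Qed.

(** Rows and columns may be repeated, which gives 0, or permuted, which gives a
    sign, so that minors along arbitrary maps are in the ideal. *)
Lemma mem_minor_ideal k p q (M : 'M[A]_(p, q)) (f : 'I_k -> 'I_p) (g : 'I_k -> 'I_q) :
  ideal_gen (minors k M) (\det (mxsub f g M)).
Proof.
have det0 p' q' (M' : 'M[A]_(p', q')) (f' : 'I_k -> 'I_p') g' : ~ injective f' ->
    \det (mxsub f' g' M') = 0.
  move=> /injectiveP/injectivePn[i [j ij fij]].
  by apply: (determinant_alternate ij) => l; rewrite !mxE fij.
have [f_inj|nf] := pselect (injective f); last first.
  by rewrite det0 //; apply: ideal_0.
have [g_inj|ng] := pselect (injective g); last first.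
  by rewrite -det_tr trmx_mxsub det0 //; apply: ideal_0.
have [s fs] := rows_sort f_inj; have [t gt] := rows_sort g_inj.
have -> : mxsub f g M = row_perm s^-1 (col_perm t^-1 (mxsub (f \o s) (g \o t) M)).
  by apply/matrixP => i j; rewrite !mxE /= !permKV.
rewrite row_permE col_permE !det_mulmx; apply/ideal_M/ideal_Mr.
by apply: mem_ideal_gen; exists (f \o s), (g \o t).
Qed.

(** The multilinear expansion behind the Cauchy-Binet formula, before the terms
    with a repeated row are removed. *)
Lemma det_mul_rect k p (B : 'M[A]_(k, p)) (C : 'M[A]_(p, k)) :
  \det (B *m C) = \sum_(phi : {ffun 'I_k -> 'I_p}) (\prod_i B i (phi i)) * \det (rowsub phi C).
Proof.
rewrite /determinant.
under eq_bigr => s _.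
  under eq_bigr do rewrite mxE.
  rewrite bigA_distr_bigA mulr_sumr.
  over.
rewrite exchange_big; apply: eq_bigr => phi _; rewrite mulr_sumr; apply: eq_bigr => s _.
rewrite mulrCA big_split; congr (_ * (_ * _)); apply: eq_bigr => i _.
by rewrite !mxE.
Qed.

Lemma minor_ideal_mull k p p' q (G : 'M[A]_(p', p)) (M : 'M[A]_(p, q)) m :
  minors k (G *m M) m -> ideal_gen (minors k M) m.
Proof.
case=> f [g [_ _ ->]]; rewrite mxsub_mul det_mul_rect; apply: ideal_bigsum => phi _.
apply: ideal_M; rewrite (_ : rowsub _ _ = mxsub phi g M); first exact: mem_minor_ideal.
by apply/matrixP => i j; rewrite !mxE.
Qed.

Lemma minor_ideal_mulr k p q q' (M : 'M[A]_(p, q)) (G : 'M[A]_(q, q')) m :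
  minors k (M *m G) m -> ideal_gen (minors k M) m.
Proof.
move/minors_tr; rewrite trmx_mul => /minor_ideal_mull; apply: ideal_gen_sub => x /minors_tr.
by rewrite trmxK => ?; apply: mem_ideal_gen.
Qed.

Lemma minors_map (B : comNzRingType) (phi : {rmorphism A -> B}) k p q (M : 'M[A]_(p, q)) m :
  minors k M m -> minors k (map_mx phi M) (phi m).
Proof.
by case=> f [g [fh gh ->]]; exists f, g; split=> //; rewrite -det_map_mx map_mxsub.
Qed.

End MinorIdeal.

Section IdealMap.
Variables (A B : comPzRingType) (phi : {rmorphism A -> B}).

Lemma ideal_gen_map (G : set A) (I : ideal B) :
  (forall x, G x -> I (phi x)) -> forall x, ideal_gen G x -> I (phi x).
Proof.
move=> GI _ [s sG ->]; rewrite rmorph_sum big_seq; apply: ideal_bigsum => p /sG Gp.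
by rewrite rmorphM; apply/ideal_M/GI.
Qed.

End IdealMap.

(** * Hessenberg ideals *)

Section HessIdeal.
Variables (A : comNzRingType) (n : nat) (h : 'I_n -> 'I_n).
Local Notation mp := {mpoly A[n * n]}.
Local Notation Z := (Zmx A n).
Local Notation cst := (map_mx (@mpolyC (n * n) A)).
Implicit Types (x y g : 'M[A]_n) (i : 'I_n).

Lemma hess_ideal_map (B : comNzRingType) (phi : {rmorphism mp -> B}) x (I : ideal B) :
  (forall i m, ((h i).+1 < n)%N -> minors (h i).+2 (hess_mx x h i) m -> I (phi m)) ->
  forall f, hess_ideal x h f -> I (phi f).
Proof.
move=> sub _ [f fI ->]; rewrite rmorph_sum; apply: ideal_bigsum => i _.
apply: ideal_gen_map (fI i) => m; case: ifP => // hi; exact: sub.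
Qed.

Lemma hess_ideal_sub x (I : ideal mp) :
  (forall i m, ((h i).+1 < n)%N -> minors (h i).+2 (hess_mx x h i) m -> I m) ->
  forall f, hess_ideal x h f -> I f.
Proof. exact: (@hess_ideal_map _ idfun). Qed.

Lemma mem_hess_ideal x i m : ((h i).+1 < n)%N ->
  ideal_gen (minors (h i).+2 (hess_mx x h i)) m -> hess_ideal x h m.
Proof.
move=> hi; apply: ideal_gen_sub => {}m mm.
exists (fun j => if j == i then m else 0).
  move=> j; case: eqP => [->|_]; last exact: ideal_0.
  by rewrite /hess_ideal_at hi; apply: mem_ideal_gen.
by rewrite (bigD1 i) //= eqxx big1 ?addr0 // => j /negbTE ->.
Qed.

(** As i <= h i, the columns v_0, ..., v_i are among v_0, ..., v_h(i), so that
    adding c v_j to a x v_j is a column operation. *)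
Lemma hess_ideal_affine (a c : A) x : hessenberg h ->
  forall f, hess_ideal (a *: x + c%:M) h f -> hess_ideal x h f.
Proof.
move=> [_ hge]; apply: hess_ideal_sub => i m hi mm; apply: (mem_hess_ideal hi).
pose sel : 'M[mp]_((h i).+1, i.+1) := \matrix_(p, q) (p == q :> nat)%:R.
have E : hess_mx (a *: x + c%:M) h i =
    hess_mx x h i *m block_mx (a%:MP)%:M 0 (c%:MP *: sel) 1%:M.
  rewrite /hess_mx mul_row_block !mulmx0 mulmx1 add0r; congr row_mx.
  rewrite map_mxD map_mxZ map_scalar_mx mulmxDl -scalemxAl mul_scalar_mx.
  rewrite mul_mx_scalar -scalemxAr; apply/matrixP => p q; rewrite !mxE.
  congr (_ * _ + _ * _).
  have qh : (q < (h i).+1)%N by rewrite ltnS (leq_trans _ (hge i)) // -ltnS.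
  rewrite (bigD1 (Ordinal qh)) //= !mxE eqxx mulr1 big1 ?addr0.
    by congr ('X_(mxvec_index _ _)); apply: val_inj.
  move=> r; rewrite -val_eqE /= !mxE => /negbTE ->; exact: mulr0.
by rewrite E in mm; apply: minor_ideal_mulr mm.
Qed.

Definition subst (W : 'M[mp]_n) : mp -> mp :=
  comp_mpoly [tuple mxvec W 0 v | v < n * n].

HB.instance Definition _ W := GRing.LRMorphism.on (subst W).

Lemma substC W c : subst W c%:MP = c%:MP.
Proof. exact: comp_mpolyC. Qed.

Lemma subst_Z W : map_mx (subst W) Z = W.
Proof.
apply/matrixP => i j; rewrite !mxE /subst comp_mpolyXU -tnth_nth tnth_mktuple.
exact: mxvecE.
Qed.

Lemma subst_cst W x : map_mx (subst W) (cst x) = cst x.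
Proof. by apply/matrixP => i j; rewrite !mxE substC. Qed.

Lemma map_hess_mx (B : comNzRingType) (phi : {rmorphism mp -> B}) x i :
  map_mx phi (hess_mx x h i) =
  row_mx (colsub (widen_ord (ltn_ord i)) (map_mx phi (cst x) *m map_mx phi Z))
         (colsub (widen_ord (ltn_ord (h i))) (map_mx phi Z)).
Proof. by rewrite /hess_mx map_row_mx /first_cols !map_mxsub map_mxM. Qed.

Lemma rmorph_id_on_vars (F : {rmorphism mp -> mp}) :
  (forall c, F c%:MP = c%:MP) -> (forall i j, F (Z i j) = Z i j) -> F =1 id.
Proof.
move=> FC FZ f; rewrite [in LHS](mpolyE f) [RHS](mpolyE f) rmorph_sum.
apply: eq_bigr => m _; rewrite -mul_mpolyC rmorphM /= FC; congr (_ * _).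
rewrite mpolyXE_id rmorph_prod; apply: eq_bigr => v _; rewrite rmorphXn; congr (_ ^+ _).
by case/mxvec_indexP: v => i j; have := FZ i j; rewrite mxE.
Qed.

End HessIdeal.

Lemma mspan_ideal (A : comNzRingType) N T (G : T -> {mpoly A[N]}) P
    (I : ideal {mpoly A[N]}) q f :
  mspan G P f -> (forall w t, P w t -> I (q * G t)) -> I (q * f).
Proof.
move=> fP sub; elim: fP => [|c w t /sub qt|x y _ IHx _ IHy].
- by rewrite mulr0; apply: ideal_0.
- by rewrite -scalerAr -mul_mpolyC; apply: ideal_M; rewrite mulrCA; apply: ideal_M.
- by rewrite mulrDr; apply: ideal_D.
Qed.

(** * The rank one standard form *)

Section StandardForm.
Variables (A : idomainType) (n : nat) (h : 'I_n -> 'I_n) (tau : A).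
Hypotheses (n_gt1 : (1 < n)%N) (hh : hessenberg h).
Local Notation mp := {mpoly A[n * n]}.
Local Notation Z := (Zmx A n).
Local Notation cst := (map_mx (@mpolyC (n * n) A)).

Definition standard : 'M[A]_n := tau *: matrix_unit A n 1 1 + matrix_unit A n 1 n.

Lemma rvar_proof i j : (n * n - (i * n + j).+1 < n * n)%N.
Proof. by rewrite ltn_subrL muln_gt0 !(ltnW n_gt1). Qed.

(** A numbering of the entries from the bottom right corner. *)
Definition rvar i j : 'I_(n * n) := Ordinal (rvar_proof i j).

Lemma rvar_lt i j i' j' :
  (i < n)%N -> (j < n)%N -> (i' < n)%N -> (j' < n)%N ->
  (i' < i)%N || (i' == i) && (j' < j)%N -> (rvar i j < rvar i' j')%N.
Proof.
move=> i_n jn i'n j'n lt /=.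
have le x y : (x < n)%N -> (y < n)%N -> (x * n + y < n * n)%N.
  move=> xn yn; apply: (@leq_trans (x.+1 * n)); first by rewrite mulSn addnC ltn_add2r.
  by rewrite leq_mul2r xn orbT.
suff : (i' * n + j' < i * n + j)%N by have := le _ _ i_n jn; lia.
case/orP: lt => [lt|/andP[/eqP-> lt]]; last by rewrite ltn_add2l.
apply: (@leq_trans (i'.+1 * n)); first by rewrite mulSn addnC ltn_add2r.
by apply: (@leq_trans (i * n)); [rewrite leq_mul2r lt orbT | rewrite leq_addr].
Qed.

(** The Hessenberg function with values in 1, ..., n, extended to nat. *)
Definition hsize (j : nat) : nat := oapp (fun i => (h i).+1) 0%N (insub j).

Lemma hsizeE (i : 'I_n) : hsize i = (h i).+1.
Proof. by rewrite /hsize valK. Qed.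

Lemma hsize_mono i j : (i <= j < n)%N -> (hsize i <= hsize j)%N.
Proof.
move=> /andP[ij jn]; have i_n := leq_ltn_trans ij jn.
by rewrite (hsizeE (Ordinal i_n)) (hsizeE (Ordinal jn)) ltnS; case: hh => hm _; apply: hm.
Qed.

Lemma hsize_gt j : (j < n)%N -> (j < hsize j <= n)%N.
Proof.
move=> jn; rewrite (hsizeE (Ordinal jn)) ltnS ltn_ord andbT.
by case: hh => _ /(_ (Ordinal jn)).
Qed.

Let i0 : 'I_n := Ordinal (ltnW n_gt1).
Let last_lt : (n.-1 < n)%N. Proof. by lia. Qed.
Let ilast : 'I_n := Ordinal last_lt.

Lemma standard_mul (W : 'M[mp]_n) p q :
  (cst standard *m W) p q = (p == i0)%:R * (W ilast q + tau *: W i0 q).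
Proof.
rewrite mxE (bigD1 i0) //= (bigD1 ilast) /=; last by rewrite -val_eqE /=; lia.
rewrite big1 ?addr0 => [|r]; last first.
  rewrite -!val_eqE /= !mxE => /andP[r0 rn]; have -> : (r.+1 == 1)%N = false by lia.
  have -> : (r.+1 == n)%N = false by lia.
  by rewrite !andbF mulr0n mulr0 addr0 mpolyC0 mul0r.
rewrite ![map_mx _ _ _ _]mxE !mxE -[p == i0]val_eqE /=.
have -> : (p.+1 == 1)%N = (p == 0 :> nat) by lia.
have -> : (1 == n)%N = false by lia.
have -> : (n.-1.+1 == 1)%N = false by lia.
have -> : (n.-1.+1 == n)%N by lia.
case: eqP => _ /=; last by rewrite mulr0 addr0 mpolyC0 !mul0r addr0.
by rewrite mulr0 mulr1 addr0 add0r mpolyC1 !mul1r addrC mul_mpolyC.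
Qed.

Local Notation minor := (initial_minor rvar A).
Let ideal_std : ideal mp := gen_ideal n rvar hsize tau.
Let Zr : 'M[mp]_n := \matrix_(i, j) 'X_(rvar i j).
Local Notation rho := (subst Zr).

Lemma mem_gen_ideal i j a : (j <= i < n)%N -> (hsize i < n)%N ->
  positive_rows n (hsize i) a -> ideal_std (ell n rvar tau j * minor (hsize i) a).
Proof.
move=> /andP[ji i_n] kn pa; have kji : (hsize j <= hsize i)%N by apply: hsize_mono; lia.
apply: mspan_ideal (minor_truncate rvar_lt A kji (ltnW kn) pa) _ => w b [pb _].
apply: mem_ideal_gen; exists (j, b) => //; split=> //=; first exact: leq_ltn_trans i_n.
exact: leq_ltn_trans kn.
Qed.

(** A minor of [x v_0 ... x v_i  v_0 ... v_h(i)] is the determinant of a product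
    B C of square matrices, where B consists of the columns v_0, ..., v_h(i) and
    e_0. The last row of C contains the forms l_j with j <= i, and det B is a
    minor of Z without the row 0, up to sign, or 0. *)
Lemma rho_hess f : hess_ideal standard h f -> ideal_std (rho f).
Proof.
apply: hess_ideal_map => i m hi [f' [g' [finc _ ->]]].
set k := (h i).+1 in f' g' finc *.
rewrite -det_map_mx map_mxsub map_hess_mx subst_cst subst_Z.
set M := row_mx _ _.
pose lam (r : 'I_k.+1) := if split (g' r) is inl j then ell n rvar tau j else 0 : mp.
pose B : 'M[mp]_k.+1 := \matrix_(p, q)
  if q == k :> nat then (f' p == i0)%:R else 'X_(rvar (f' p) q).
pose C : 'M[mp]_k.+1 := \matrix_(q, r) if q == k :> nat then lam r
   else if split (g' r) is inr c then (c == q :> nat)%:R else 0.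
have -> : mxsub f' g' M = B *m C.
  apply/matrixP => p r; rewrite [LHS]mxE [RHS]mxE big_ord_recr /= !mxE eqxx /lam.
  case E: (split (g' r)) => [c|c].
    rewrite mxE standard_mul big1 ?add0r.
      by rewrite !mxE.
    by move=> q _; rewrite !mxE /= ltn_eqF // E mulr0.
  have ck : (c < k)%N by [].
  rewrite mulr0 addr0 mxE (bigD1 (Ordinal ck)) //= !mxE /= E eqxx ltn_eqF // mulr1.
  rewrite big1 ?addr0 // => q; rewrite -val_eqE /= eq_sym => cq.
  by rewrite !mxE /= ltn_eqF // E (negbTE cq) mulr0.
rewrite det_mulmx.
rewrite (expand_det_row C ord_max) mulr_sumr; apply: ideal_bigsum => r _.
rewrite mulrCA mulrA; apply: ideal_Mr; rewrite mxE eqxx /lam.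
case: split => j; last by rewrite mul0r; apply: ideal_0.
pose a p := oapp (fun p : 'I_k => val (f' (lift ord0 p))) 0%N (insub p).
have aE (p : 'I_k) : a p = f' (lift ord0 p) by rewrite /a valK.
have -> : \det B = (f' ord0 == i0)%:R * ((-1) ^+ k * minor k a).
  rewrite (expand_det_col B ord_max) (bigD1 ord0) //= big1 ?addr0 => [|p p0]; last first.
    rewrite mxE eqxx; have : (f' ord0 < f' p)%N by apply: finc; rewrite lt0n.
    by rewrite -val_eqE /=; case: eqP => [->|]; rewrite ?ltn0 ?mul0r.
  rewrite mxE eqxx; congr (_ * (_ * \det _)); apply/matrixP => p q.
  by rewrite !mxE lift_max (ltn_eqF (ltn_ord q)) aE.
rewrite mulrCA; apply: ideal_M; rewrite mulrCA; apply: ideal_M.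
rewrite /k -hsizeE; apply: mem_gen_ideal; rewrite ?hsizeE //.
  by rewrite -ltnS !ltn_ord.
split=> [p q /andP[pq qk]|p pk].
  have pk := ltn_trans pq qk; rewrite (aE (Ordinal pk)) (aE (Ordinal qk)).
  by apply: finc; rewrite !lift0.
rewrite (aE (Ordinal pk)) ltn_ord andbT.
by apply: leq_ltn_trans (finc ord0 (lift ord0 (Ordinal pk)) _).
Qed.

(** A left inverse of the renumbering substitution. *)
Definition rvar_inverse : mp -> mp := comp_mpoly
  [tuple (if [pick ij : 'I_n * 'I_n | v == rvar ij.1 ij.2] is Some ij
          then Z ij.1 ij.2 else 0) | v < n * n].

HB.instance Definition _ := GRing.LRMorphism.on rvar_inverse.
Local Notation sigma := rvar_inverse.

Let sigmaX (i j : 'I_n) : sigma 'X_(rvar i j) = Z i j.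
Proof.
rewrite /rvar_inverse comp_mpolyXU -tnth_nth tnth_mktuple.
case: pickP => [[i' j'] /= /eqP/(var_inj rvar_lt) [] // /val_inj <- /val_inj <-|] //.
by move=> /(_ (i, j)); rewrite eqxx.
Qed.

Let sigmaC c : sigma c%:MP = c%:MP.
Proof. exact: comp_mpolyC. Qed.

Let rhoK f : sigma (rho f) = f.
Proof.
apply: (@rmorph_id_on_vars _ _ (GRing.RMorphism.clone _ _ (sigma \o rho) _)).
  by move=> c; rewrite /= substC sigmaC.
move=> i j; have := subst_Z Zr => /matrixP/(_ i j); rewrite [LHS]mxE /= => ->.
by rewrite mxE sigmaX.
Qed.

(** Conversely l_j D is the minor with the row 0, the rows of D, the column x v_j
    and the columns of D: the column x v_j = l_j e_0 has a single nonzero entry. *)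
Let sigma_gen f : ideal_std f -> hess_ideal standard h (sigma f).
Proof.
apply: ideal_gen_map => {f} _ [[j a] [/= jn kn [inc bnd]] ->].
pose i := Ordinal jn; have kE : hsize j = (h i).+1 by rewrite (hsizeE i).
rewrite kE in kn inc bnd; set k := (h i).+1 in kE kn inc bnd.
apply: (mem_hess_ideal kn).
pose f (p : 'I_k.+1) : 'I_n := oapp (fun q : 'I_k => insubd i0 (a q)) i0 (unlift ord0 p).
pose g (p : 'I_k.+1) : 'I_(i.+1 + k) :=
  oapp (@rshift i.+1 k) (lshift k ord_max) (unlift ord0 p).
have fl (q : 'I_k) : f (lift ord0 q) = a q :> nat.
  by rewrite /f liftK /= val_insubd; have /andP[_ ->] := bnd q (ltn_ord q).
have gl (q : 'I_k) : g (lift ord0 q) = rshift i.+1 q by rewrite /g liftK.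
have g0 : g ord0 = lshift k ord_max by rewrite /g unlift_none.
have f0 : f ord0 = i0 by rewrite /f unlift_none.
suff E : sigma (gen n rvar hsize tau (j, a)) = \det (mxsub f g (hess_mx standard h i)).
  by have := mem_minor_ideal (hess_mx standard h i) f g; rewrite -E.
rewrite (expand_det_col _ ord0) big_ord_recl big1 ?addr0 => [|q _]; last first.
  rewrite mxE g0 row_mxEl mxE standard_mul.
  have -> : (f (lift ord0 q) == i0) = false.
    by rewrite -val_eqE /= fl; have := bnd q (ltn_ord q); lia.
  by rewrite !mul0r.
rewrite /gen /= kE rmorphM; congr (_ * _).
  rewrite mxE g0 row_mxEl mxE standard_mul f0 eqxx mul1r /ell.
  have -> : widen_ord (ltn_ord i) ord_max = i by apply: val_inj.
  rewrite -mul_mpolyC rmorphD rmorphM /= sigmaC -(sigmaX ilast i) -(sigmaX i0 i).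
  by rewrite mul_mpolyC.
rewrite /cofactor expr0 mul1r /initial_minor -det_map_mx; congr (\det _).
apply/matrixP => p q; rewrite 3![RHS]mxE gl row_mxEr [RHS]mxE.
by rewrite -sigmaX [LHS]mxE [in LHS]mxE fl.
Qed.

Let rhoD f g (c : A) : rho (c *: f + g) = c *: rho f + rho g.
Proof. by rewrite linearP. Qed.

Lemma standard_has_normal_form : has_normal_form (hess_ideal standard h).
Proof.
have [NF [NF_lin NF_id NF_0]] :=
  gen_ideal_normal_form rvar_lt tau n_gt1 hsize_mono hsize_gt.
exists (sigma \o NF \o rho); split=> [c f g|f|f /rho_hess/NF_0 If] /=.
- by rewrite rhoD NF_lin linearP.
- by rewrite -[X in X - _]rhoK -rmorphB; apply/sigma_gen/NF_id.
- by rewrite If rmorph0.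
Qed.

Lemma standard_det f : hess_ideal standard h (\det Z * f) -> hess_ideal standard h f.
Proof.
move=> /rho_hess; rewrite rmorphM /= -det_map_mx subst_Z => If.
rewrite -(rhoK f); apply: sigma_gen.
apply: (gen_ideal_det rvar_lt n_gt1 hsize_mono hsize_gt).
move: If; congr (ideal_std (_ * _)).
Qed.

End StandardForm.

(** * Flatness of projective modules *)

(** A module with a dual basis, that is, a retract of a free module, is flat: an
    element of the tensor product N (x) M is determined by its coordinates in N, and
    a linear map N -> N' acts on these coordinates. *)
Section FlatDualBasis.
Variables (A : comPzRingType) (M : lmodType A) (T : eqType).
Variables (b : T -> M) (co : T -> M -> A).
Hypothesis co_lin : forall t a x y, co t (a *: x + y) = a * co t x + co t y.
Hypothesis co_basis : forall x, exists r : seq T,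
  [/\ uniq r, forall t, t \notin r -> co t x = 0 & x = \sum_(t <- r) co t x *: b t].

Let coD t x y : co t (x + y) = co t x + co t y.
Proof. by rewrite -[x in LHS]scale1r co_lin mul1r. Qed.

Let co0 t : co t 0 = 0.
Proof. by apply: (@addrI _ (co t 0)); rewrite -coD !addr0. Qed.

Let coZ t a x : co t (a *: x) = a * co t x.
Proof. by rewrite -[a *: x]addr0 co_lin co0 addr0. Qed.

Definition tens_coord (N : lmodType A) t (s : seq (N * M)) : N :=
  \sum_(p <- s) co t p.2 *: p.1.

Lemma tens_coord_eq (N : lmodType A) t (s s' : seq (N * M)) :
  tens_eq s s' -> tens_coord t s = tens_coord t s'.
Proof.
rewrite /tens_coord; elim=> {s s'} //=.
- by move=> s s' s'' _ -> _ ->.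
- by move=> s s' u u' _ E _ E'; rewrite !big_cat /= E E'.
- by move=> s s'; rewrite !big_cat /= addrC.
- by move=> m; rewrite big_seq1 big_nil scaler0.
- by move=> n n' m; rewrite big_seq1 !big_cons big_nil addr0 /= scalerDr.
- by move=> n m m'; rewrite big_seq1 !big_cons big_nil addr0 /= coD scalerDl.
- by move=> a n m; rewrite !big_seq1 /= coZ scalerA mulrC.
Qed.

Lemma tens_eq_cons (N : lmodType A) (p : N * M) s s' :
  tens_eq s s' -> tens_eq (p :: s) (p :: s').
Proof. by move=> ss'; apply: (Tens_cat (Tens_refl [:: p]) ss'). Qed.

Lemma tens_eq_zeror (N : lmodType A) (n : N) : tens_eq [:: (n, 0 : M)] [::].
Proof.
have := Tens_scale 0 n (0 : M); rewrite !scale0r => /Tens_sym E.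
exact: (Tens_trans E (Tens_zero _ _)).
Qed.

Lemma tens_eq_suml (N : lmodType A) (r : seq T) (F : T -> N) :
  (forall t, t \in r -> F t = 0) -> tens_eq [seq (F t, b t) | t <- r] [::].
Proof.
elim: r => [|t r IH] F0; first exact: Tens_refl.
rewrite /= F0 ?mem_head //; apply: (Tens_cat (Tens_zero _ _) (IH _)) => u ur.
by rewrite F0 // in_cons ur orbT.
Qed.

Lemma tens_eq_sumD (N : lmodType A) (r : seq T) (F G : T -> N) :
  tens_eq ([seq (F t, b t) | t <- r] ++ [seq (G t, b t) | t <- r])
    [seq (F t + G t, b t) | t <- r].
Proof.
elim: r => [|t r IH] /=; first exact: Tens_refl.
apply: Tens_trans (_ : tens_eq ((F t, b t) :: (G t, b t) :: _) _); last first.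
  by apply: (Tens_cat (Tens_sym (Tens_addl _ _ _)) IH).
apply: tens_eq_cons; rewrite -cat1s catA -[_ :: _ ++ _]cat1s catA.
apply: Tens_cat (Tens_refl _); exact: Tens_comm.
Qed.

Lemma tens_eq_sumr (N : lmodType A) (r : seq T) n (F : T -> A) :
  tens_eq [:: (n : N, \sum_(t <- r) F t *: b t)] [seq (F t *: n, b t) | t <- r].
Proof.
elim: r => [|t r IH]; first by rewrite big_nil; apply: tens_eq_zeror.
rewrite big_cons; apply: Tens_trans (Tens_addr _ _ _) _.
exact: (Tens_cat (Tens_sym (Tens_scale _ _ _)) IH).
Qed.

(** The element is the sum of its coordinates tensored with the b t; any finite
    set of indices that is large enough can be used, which allows two elements
    to be compared. *)
Lemma tens_expand (N : lmodType A) (s : seq (N * M)) : exists r0 : seq T,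
  forall r, uniq r -> {subset r0 <= r} ->
    tens_eq s [seq (tens_coord t s, b t) | t <- r].
Proof.
elim: s => [|[n m] s [r0 IH]].
  exists [::] => r _ _; apply/Tens_sym/tens_eq_suml => t _.
  by rewrite /tens_coord big_nil.
have [r1 [ur1 out1 mE]] := co_basis m.
exists (r1 ++ r0) => r ur sub; rewrite -cat1s.
have sub1 t : t \in r1 -> t \in r by move=> tr; apply: sub; rewrite mem_cat tr.
have sub0 t : t \in r0 -> t \in r by move=> tr; apply: sub; rewrite mem_cat tr orbT.
have mE' : m = \sum_(t <- r) co t m *: b t.
  rewrite (bigID (mem r1)) /= [X in _ + X]big1 ?addr0 => [|t /out1 ->]; last exact: scale0r.
  rewrite -big_filter {1}mE; apply: perm_big; apply: uniq_perm => //.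
    exact: filter_uniq.
  by move=> t; rewrite mem_filter; case: (boolP (t \in r1)) => // /sub1.
have nm : tens_eq [:: (n, m)] [seq (co t m *: n, b t) | t <- r].
  by rewrite {1}mE'; apply: tens_eq_sumr.
apply: (Tens_trans (Tens_cat nm (IH r ur sub0))).
apply: Tens_trans (tens_eq_sumD _ _ _) _.
rewrite [X in tens_eq _ X](_ : _ = [seq (co t m *: n + tens_coord t s, b t) | t <- r]).
  exact: Tens_refl.
by apply: eq_map => t; rewrite /tens_coord big_cons.
Qed.

Lemma flat_dual_basis : flat_module M.
Proof.
move=> N N' f f_inj x y; rewrite -[x]reprK -[y]reprK.
set s := repr x; set s' := repr y; rewrite -!/(tens_sum _) !tens_mapE => /tens_sumP E.
apply/tens_sumP.
have co_map t u : tens_coord t (tens_map1 f u) = f (tens_coord t u).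
  rewrite /tens_coord /tens_map1 big_map raddf_sum.
  by apply: eq_bigr => p _; rewrite /= linearZ.
have ss' t : tens_coord t s = tens_coord t s'.
  by apply: f_inj; rewrite -!co_map; apply: tens_coord_eq.
have [r0 E0] := tens_expand s; have [r1 E1] := tens_expand s'.
pose r := undup (r0 ++ r1); have ur : uniq r := undup_uniq _.
have {}E0 := E0 r ur; have {}E1 := E1 r ur.
apply: Tens_trans (E0 _) _; first by move=> t tr; rewrite mem_undup mem_cat tr.
rewrite (eq_map (g := fun t => (tens_coord t s', b t))) => [|t]; last by rewrite ss'.
by apply/Tens_sym/E1 => t tr; rewrite mem_undup mem_cat tr orbT.
Qed.

End FlatDualBasis.

(** * Quotient rings and isomorphisms of affine schemes *)

Section QuotientFacts.

Lemma quot_pi_eq0 (A : comPzRingType) (I : ideal A) x : quot_pi I x = 0 <-> I x.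
Proof.
rewrite -[0](rmorph0 (quot_pi I)); split=> [/quot_piP|Ix]; rewrite ?subr0 //.
by apply/quot_piP; rewrite subr0.
Qed.

Lemma quot_pi_surj (A : comPzRingType) (I : ideal A) (y : quotient I) :
  exists x, quot_pi I x = y.
Proof. by exists (repr y); apply: quot_repr. Qed.

(** Two quotients of the same ring A by the same ideal; the quotients are given
    by surjective morphisms so that iterated quotients are covered. *)
Lemma isomorphic_of_kernels (k A : comPzRingType) (X Y : affine_scheme k)
    (alpha : {rmorphism A -> coord_ring X}) (beta : {rmorphism A -> coord_ring Y}) :
  (forall y, exists x, alpha x = y) -> (forall y, exists x, beta x = y) ->
  (forall x, alpha x = 0 <-> beta x = 0) ->
  (forall c, exists2 x, alpha x = structure_map X c & beta x = structure_map Y c) ->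
  isomorphic X Y.
Proof.
move=> /choice[sa saK] /choice[sb sbK] ker str.
pose F y := beta (sa y); pose G y := alpha (sb y).
have Fa x : F (alpha x) = beta x.
  apply/eqP; rewrite -subr_eq0 -rmorphB; apply/eqP/ker.
  by rewrite rmorphB saK subrr.
have Gb x : G (beta x) = alpha x.
  apply/eqP; rewrite -subr_eq0 -rmorphB; apply/eqP/ker.
  by rewrite rmorphB sbK subrr.
have FB : zmod_morphism F.
  by move=> x y; rewrite -[x]saK -[y]saK -rmorphB !Fa rmorphB.
have FM : monoid_morphism F.
  split; first by rewrite -(rmorph1 alpha) Fa rmorph1.
  by move=> x y; rewrite -[x]saK -[y]saK -rmorphM !Fa rmorphM.
pose F' : {rmorphism coord_ring X -> coord_ring Y} := HB.pack F
  (GRing.isZmodMorphism.Build _ _ F FB) (GRing.isMonoidMorphism.Build _ _ F FM).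
exists F'; split=> [|c]; last by have [x <- <-] := str c; apply: Fa.
by exists G => y /=; [rewrite -[y]saK Fa Gb | rewrite -[y]sbK Gb Fa].
Qed.

Lemma isomorphic_trans (k : comPzRingType) (X Y W : affine_scheme k) :
  isomorphic X Y -> isomorphic Y W -> isomorphic X W.
Proof.
move=> [f [f_bij fX]] [g [g_bij gY]]; exists (g \o f : {rmorphism _ -> _}); split.
  exact: bij_comp.
by move=> a; rewrite /= fX gY.
Qed.

End QuotientFacts.

(** * Conjugation, scalar shifts and saturation *)

Section Conjugation.
Variables (A : idomainType) (n : nat) (h : 'I_n -> 'I_n).
Local Notation mp := {mpoly A[n * n]}.
Local Notation Z := (Zmx A n).
Local Notation cst := (map_mx (@mpolyC (n * n) A)).
Implicit Types (x y g : 'M[A]_n).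

Lemma conjugate_intro x y g : g \in unitmx -> x *m g = g *m y -> conjugate x y.
Proof. by move=> gu E; exists g => //; rewrite -E mulmxK. Qed.

Lemma conjugate_sym x y : conjugate x y -> conjugate y x.
Proof.
case=> g gu ->; exists (invmx g); first by rewrite unitmx_inv.
by rewrite invmxK -!mulmxA mulKmx // mulVmx // mulmx1.
Qed.

Lemma conjugate_scalarD c x y : conjugate x y -> conjugate (c%:M + x) (c%:M + y).
Proof.
case=> g gu ->; exists g => //.
by rewrite mulmxDr mulmxDl scalar_mxC mulmxK.
Qed.

Definition move_Z g : mp -> mp := subst (cst g *m Z).
HB.instance Definition _ g := GRing.LRMorphism.on (move_Z g).

Lemma move_Z_Z g : map_mx (move_Z g) Z = cst g *m Z.
Proof. exact: subst_Z. Qed.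

Lemma move_Z_cst g x : map_mx (move_Z g) (cst x) = cst x.
Proof. exact: subst_cst. Qed.

(** Under Z -> g Z the matrix of columns of g x g^-1 becomes g times the one of x:
    this is a row operation. *)
Lemma move_Z_hess g x f : g \in unitmx ->
  hess_ideal (g *m x *m invmx g) h f -> hess_ideal x h (move_Z g f).
Proof.
move=> gu; apply: hess_ideal_map => i m hi mm; apply: (mem_hess_ideal hi).
apply: (@minor_ideal_mull _ _ _ _ _ (cst g)).
have := minors_map (move_Z g) mm.
rewrite map_hess_mx move_Z_Z move_Z_cst.
rewrite mulmxA -(map_mxM (@mpolyC (n * n) A)) mulmxKV // map_mxM -mulmxA.
by rewrite -!mulmx_colsub -mul_mx_row mulmx_colsub.
Qed.

Lemma move_Z_K g f : g \in unitmx -> move_Z g (move_Z (invmx g) f) = f.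
Proof.
move=> gu.
apply: (@rmorph_id_on_vars _ _ (GRing.RMorphism.clone _ _ (move_Z g \o move_Z (invmx g)) _)).
  by move=> c; rewrite /= /move_Z !substC.
move=> i j.
have E : map_mx (move_Z g) (map_mx (move_Z (invmx g)) Z) = Z.
  apply: (etrans (congr1 (map_mx (move_Z g)) (move_Z_Z (invmx g)))).
  rewrite map_mxM move_Z_cst move_Z_Z mulmxA.
  by rewrite -(map_mxM (@mpolyC (n * n) A)) mulVmx // map_mx1 mul1mx.
by move/matrixP: E => /(_ i j); rewrite mxE [in LHS]mxE.
Qed.

Lemma move_Z_VK g f : g \in unitmx -> move_Z (invmx g) (move_Z g f) = f.
Proof. by move=> gu; rewrite -{2}[g]invmxK move_Z_K ?unitmx_inv. Qed.

Lemma move_Z_hessE g x f : g \in unitmx ->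
  hess_ideal (g *m x *m invmx g) h f <-> hess_ideal x h (move_Z g f).
Proof.
move=> gu; split; first exact: move_Z_hess.
move=> Ix; rewrite -(move_Z_VK f gu).
apply: (@move_Z_hess (invmx g)); first by rewrite unitmx_inv.
have -> : invmx g *m (g *m x *m invmx g) *m invmx (invmx g) = x.
  by rewrite invmxK -!mulmxA mulKmx // mulVmx // mulmx1.
exact: Ix.
Qed.

Lemma move_Z_det g : move_Z g (\det Z) = (\det g)%:MP * \det Z.
Proof. by rewrite -det_map_mx move_Z_Z det_mulmx -det_map_mx. Qed.

Lemma unit_hess x (u : A) f : u \is a GRing.unit ->
  hess_ideal x h (u%:MP * f) -> hess_ideal x h f.
Proof.
move=> uu If; rewrite -[f]mul1r -(mpolyC1 (n * n) A) -(mulVr uu) mpolyCM -mulrA.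
exact: ideal_M.
Qed.

(** The second condition says that the ideal is its own saturation, in a form
    that is easy to transport. *)
Definition split_saturated x : Prop :=
  has_normal_form (hess_ideal x h) /\
  forall f, hess_ideal x h (\det Z * f) -> hess_ideal x h f.

Lemma split_saturated_conjugate x y : conjugate y x -> split_saturated x -> split_saturated y.
Proof.
case=> g gu -> [[NF [NF_lin NF_id NF_0]] nzd]; split.
  exists (move_Z (invmx g) \o NF \o move_Z g); split=> [c f f'|f|f] /=.
  - by rewrite linearP NF_lin linearP.
  - apply/(move_Z_hessE _ _ gu); rewrite rmorphB /= move_Z_K //; exact: NF_id.
  - by move/(move_Z_hess gu)/NF_0 => ->; rewrite rmorph0.
move=> f /(move_Z_hess gu) If; apply/(move_Z_hessE _ _ gu)/nzd.
apply: (@unit_hess _ (\det g)); first by rewrite -unitmxE.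
by rewrite mulrA -move_Z_det -rmorphM.
Qed.

Lemma hess_ideal_affineE (a c : A) x f : hessenberg h -> a \is a GRing.unit ->
  hess_ideal (a *: x + c%:M) h f <-> hess_ideal x h f.
Proof.
move=> hh au; split; first exact: hess_ideal_affine.
move=> Ix; apply: (@hess_ideal_affine _ _ _ a^-1 (- (a^-1 * c)) _ hh).
have -> : a^-1 *: (a *: x + c%:M) + (- (a^-1 * c))%:M = x.
  by rewrite scalerDr scalerA mulVr // scale1r scale_scalar_mx raddfN addrK.
exact: Ix.
Qed.

Lemma split_saturated_shift c x :
  hessenberg h -> split_saturated x -> split_saturated (c%:M + x).
Proof.
move=> hh [[NF [NF_lin NF_id NF_0]] nzd].
have E f : hess_ideal (c%:M + x) h f <-> hess_ideal x h f.
  by rewrite addrC -{1}[x]scale1r; apply: hess_ideal_affineE; rewrite ?unitr1.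
split; last by move=> f /E/nzd If; apply/E.
exists NF; split; first exact: NF_lin.
  by move=> f; apply/E/NF_id.
by move=> f /E/NF_0.
Qed.

Lemma saturation_split_saturated x f : split_saturated x ->
  hess_ideal_sat x h f <-> hess_ideal x h f.
Proof.
case=> _ nzd; split=> [[k]|If]; last by exists 0%N; rewrite expr0 mul1r.
by elim: k => [|k IH]; rewrite ?expr0 ?mul1r // exprS -mulrA => /nzd.
Qed.

(** The coordinates of a class are the coefficients of its normal form, and the
    dual basis consists of the classes of the monomials. *)
Lemma has_normal_form_flat x : has_normal_form (hess_ideal_sat x h) -> flat (hess_scheme x h).
Proof.
set I := hess_ideal_sat x h => -[NF [NF_lin NF_id NF_0]].
have NFD (f f' : mp) : NF (f + f') = NF f + NF f' by rewrite -[f in LHS]scale1r NF_lin scale1r.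
have NFq f : NF (repr (quot_pi I f)) = NF f.
  have E : I (f - repr (quot_pi I f)) by apply/quot_piP; rewrite quot_repr.
  by rewrite -[in RHS](subrK (repr (quot_pi I f)) f) NFD (NF_0 _ E) add0r.
pose M := Defs.restrict (structure_map (hess_scheme x h)).
pose co (m : 'X_{1..n * n}) (q : M) : A := (NF (repr (q : quotient I)))@_m.
pose b (m : 'X_{1..n * n}) : M := quot_pi I 'X_[m].
have scE (c : A) f : c *: (quot_pi I f : M) = quot_pi I (c *: f).
  by rewrite -[c *: f]mul_mpolyC rmorphM.
apply: (@flat_dual_basis _ _ _ b co) => [m a q r|q].
  rewrite -[q]quot_repr -[r]quot_repr /co scE -[_ + _]rmorphD !NFq NF_lin.
  by rewrite mcoeffD mcoeffZ.
exists (msupp (NF (repr (q : quotient I)))); split; first exact: msupp_uniq.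
  by move=> m; apply: memN_msupp_eq0.
under eq_bigr do rewrite scE.
rewrite -[LHS]quot_repr -[RHS](raddf_sum (quot_pi I)) -mpolyE.
exact/quot_piP/NF_id.
Qed.

Lemma split_saturated_flat x : split_saturated x -> flat (hess_scheme x h).
Proof.
move=> wb; have [[NF [NF_lin NF_id NF_0]] _] := wb; apply: has_normal_form_flat.
exists NF; split; first exact: NF_lin.
  by move=> f; apply/(saturation_split_saturated _ wb)/NF_id.
by move=> f /(saturation_split_saturated _ wb)/NF_0.
Qed.

Lemma hess_scheme_iso (phi : {rmorphism mp -> mp}) x y :
  (forall f, exists f', phi f' = f) -> (forall c, phi c%:MP = c%:MP) ->
  (forall f, hess_ideal_sat x h f <-> hess_ideal_sat y h (phi f)) ->
  isomorphic (hess_scheme x h) (hess_scheme y h).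
Proof.
move=> surj phiC IE.
apply: (@isomorphic_of_kernels _ mp (hess_scheme x h) (hess_scheme y h)
  (quot_pi (hess_ideal_sat x h)) (quot_pi (hess_ideal_sat y h) \o phi)).
- exact: quot_pi_surj.
- by move=> q; have [f <-] := quot_pi_surj q; have [g <-] := surj f; exists g.
- move=> f; apply: (iff_trans (quot_pi_eq0 (hess_ideal_sat x h) f)).
  exact: (iff_trans (IE f) (iff_sym (quot_pi_eq0 (hess_ideal_sat y h) (phi f)))).
- by move=> c; exists c%:MP; rewrite //= phiC.
Qed.

Lemma hess_scheme_conjugate x y : conjugate x y ->
  isomorphic (hess_scheme x h) (hess_scheme y h).
Proof.
case=> g gu ->; apply: (@hess_scheme_iso (GRing.RMorphism.clone _ _ (move_Z g) _)).
- by move=> f; exists (move_Z (invmx g) f); apply: move_Z_K.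
- by move=> c; apply: substC.
have du : \det g ^+ _ \is a GRing.unit by move=> k; rewrite unitrX // -unitmxE.
move=> f; split=> -[k Ik]; exists k.
- move/(move_Z_hess gu): Ik; rewrite rmorphM rmorphXn /= move_Z_det exprMn -mulrA.
  by rewrite -rmorphXn; apply/unit_hess/du.
- apply/(move_Z_hessE _ _ gu); rewrite rmorphM rmorphXn /= move_Z_det exprMn -mulrA.
  exact: (@ideal_M _ (hess_ideal y h) _ _ Ik).
Qed.

Lemma hess_scheme_affine (a c : A) x : hessenberg h -> a \is a GRing.unit ->
  isomorphic (hess_scheme (a *: x + c%:M) h) (hess_scheme x h).
Proof.
move=> hh au; apply: (@hess_scheme_iso idfun); [by move=> f; exists f | by [] | ].
move=> f; split=> -[k Ik]; exists k.
  exact: (hess_ideal_affineE c x _ hh au).1 Ik.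
exact: (hess_ideal_affineE c x _ hh au).2 Ik.
Qed.

End Conjugation.

(** * Fibers of the family *)

Section Fibers.
Variables (k : fieldType) (n : nat) (h : 'I_n -> 'I_n) (a : k).
Local Notation mpk := {mpoly k[n * n]}.
Local Notation mpt := {mpoly {poly k}[n * n]}.
Implicit Types (xt : 'M[{poly k}]_n).

Local Notation ev := (map_mpoly (horner_eval a) : mpt -> mpk).
Local Notation inc := (map_mpoly polyC : mpk -> mpt).

Let evK (f : mpk) : ev (inc f) = f.
Proof. by apply/mpolyP => m; rewrite !mcoeff_map_mpoly /= /horner_eval hornerC. Qed.

Lemma eval_ker (f : mpt) : ev f = 0 -> exists g, f = ('X - a%:P)%:MP * g.
Proof.
move=> f0; exists (\sum_(m <- msupp f) (f@_m %/ ('X - a%:P)) *: 'X_[m]).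
rewrite {1}(mpolyE f) mulr_sumr; apply: eq_bigr => m _.
rewrite mul_mpolyC scalerA mulrC divpK // dvdp_XsubCl rootE.
by have := congr1 (mcoeff m) f0; rewrite mcoeff_map_mpoly mcoeff0 => /eqP.
Qed.

Lemma eval_hess_mx xt i :
  map_mx ev (hess_mx xt h i) = hess_mx (map_mx (horner_eval a) xt) h i.
Proof.
rewrite map_hess_mx /hess_mx /first_cols.
have -> : map_mx ev (Zmx {poly k} n) = Zmx k n.
  by apply/matrixP => p q; rewrite !mxE map_mpolyX.
have -> : map_mx ev (map_mx (@mpolyC (n * n) _) xt) =
    map_mx (@mpolyC (n * n) _) (map_mx (horner_eval a) xt).
  by apply/matrixP => p q; rewrite !mxE map_mpolyC.
by [].
Qed.

Lemma eval_hess xt f :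
  hess_ideal xt h f -> hess_ideal (map_mx (horner_eval a) xt) h (ev f).
Proof.
apply: hess_ideal_map => i m hi mm; apply: (mem_hess_ideal hi); apply: mem_ideal_gen.
by rewrite -eval_hess_mx; apply: minors_map.
Qed.

Lemma eval_hess_lift xt f : hess_ideal (map_mx (horner_eval a) xt) h f ->
  exists2 g, hess_ideal xt h g & ev g = f.
Proof.
pose im f := exists2 g, hess_ideal xt h g & ev g = f.
have im0 : im 0 by exists 0; [apply: ideal_0 | apply: rmorph0].
have imD x y : im x -> im y -> im (x + y).
  move=> [x' Ix <-] [y' Iy <-]; exists (x' + y'); last by rewrite rmorphD.
  exact: (@ideal_D _ (hess_ideal xt h)).
have imM c x : im x -> im (c * x).
  move=> [x' Ix <-]; exists (inc c * x'); last by rewrite rmorphM /= evK.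
  exact: (@ideal_M _ (hess_ideal xt h)).
apply: (@hess_ideal_sub _ _ _ _ (Ideal im0 imD imM)) => i m hi.
rewrite -eval_hess_mx => -[f' [g' [fh gh ->]]]; exists (\det (mxsub f' g' (hess_mx xt h i))).
  by apply: (mem_hess_ideal hi); apply: mem_ideal_gen; exists f', g'.
by rewrite -det_map_mx map_mxsub.
Qed.

(** The unsaturated ideals specialize: the minors of x_t are mapped to those of
    x_a. As both ideals are saturated, so do the saturations. *)
Lemma hess_scheme_fiber xt : split_saturated h xt ->
  split_saturated h (map_mx (horner_eval a) xt) ->
  isomorphic (fiber (hess_scheme xt h) a)
             (hess_scheme (map_mx (horner_eval a) xt) h).
Proof.
set xa := map_mx _ xt => wt wa.
set It := hess_ideal_sat xt h; set Ia := hess_ideal_sat xa h.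
pose Y := hess_scheme xt h.
apply: (@isomorphic_of_kernels _ mpt (fiber Y a) (hess_scheme xa h)
  (quot_pi (fiber_ideal Y a) \o (quot_pi It : mpt -> coord_ring Y)) (quot_pi Ia \o ev)).
- move=> q; have [q' <-] := quot_pi_surj q; have [f <-] := quot_pi_surj q'.
  by exists f.
- by move=> q; have [f <-] := quot_pi_surj q; exists (inc f); rewrite /= evK.
- move=> f.
  apply: (iff_trans (quot_pi_eq0 (fiber_ideal Y a) (quot_pi It f))).
  apply: iff_trans (iff_sym (quot_pi_eq0 Ia (ev f))).
  apply: iff_trans (iff_sym (saturation_split_saturated (ev f) wa)).
  split=> [[s sG E]|].
    have [c cE] : exists c, quot_pi It f = quot_pi It (c * ('X - a%:P)%:MP).
      have [c cE] := quot_pi_surj (\sum_(p <- s) p.1); exists c.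
      rewrite E (quot_piM It) -[quot_mul _ _]/(quot_pi It c * quot_pi It _) [quot_pi It c]cE.
      rewrite mulr_suml big_seq [RHS]big_seq; apply: eq_bigr => p /sG.
      by move=> ->.
    have /(saturation_split_saturated _ wt)/eval_hess := (quot_piP It _ _).1 cE.
    have ev0 : ev ('X - a%:P)%:MP = 0.
      by rewrite map_mpolyC /= /horner_eval hornerXsubC subrr mpolyC0.
    by rewrite rmorphB rmorphM /= ev0 mulr0 subr0.
  move=> /eval_hess_lift[g Ig gE].
  have /eval_ker[q qE] : ev (f - g) = 0 by rewrite rmorphB /= gE subrr.
  have -> : quot_pi It f = quot_pi It q * quot_pi It ('X - a%:P)%:MP.
    rewrite -rmorphM; apply/quot_piP/(saturation_split_saturated _ wt).
    by rewrite [q * _]mulrC -qE subKr.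
  by apply: ideal_M; apply: mem_ideal_gen.
- move=> c; exists (c%:P)%:MP => //=.
  by rewrite map_mpolyC /= /horner_eval hornerC.
Qed.

End Fibers.

(** * The minimal sheet *)

Section MinimalSheet.
Variables (n : nat) (h : 'I_n -> 'I_n).
Hypotheses (n_gt1 : (1 < n)%N) (hh : hessenberg h).

Let i0 : 'I_n := Ordinal (ltnW n_gt1).
Let last_lt : (n.-1 < n)%N. Proof. by lia. Qed.
Let ilast : 'I_n := Ordinal last_lt.

Lemma standard_split_saturated (A : idomainType) (c tau : A) :
  split_saturated h (c%:M + standard n tau).
Proof.
apply: split_saturated_shift => //; split; first exact: standard_has_normal_form.
exact: standard_det.
Qed.

(** The permutation that exchanges the rows 0 and n - 2 conjugates the two matrix
    units; it fixes n - 1. *)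
Lemma matrix_unit_conjugate (A : idomainType) :
  conjugate (matrix_unit A n n.-1 n) (matrix_unit A n 1 n).
Proof.
have lt2 : (n.-2 < n)%N by lia.
pose s := tperm i0 (Ordinal lt2).
have sE (x : 'I_n) :
    s x = (if x == 0 :> nat then n.-2 else if x == n.-2 :> nat then 0 else x)%N :> nat.
  rewrite /s; case: tpermP => [->|->|/eqP + /eqP +] /=; rewrite -?val_eqE /=.
  - by [].
  - by case: eqP => [->|]; rewrite ?eqxx.
  - by do 2!case: eqP.
apply: (@conjugate_intro _ _ _ _ (perm_mx s)); first exact: unitmx_perm.
have -> : perm_mx s *m matrix_unit A n 1 n = row_perm s (matrix_unit A n 1 n).
  by rewrite row_permE.
have -> : matrix_unit A n n.-1 n *m perm_mx s = col_perm s (matrix_unit A n n.-1 n).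
  by rewrite col_permE tpermV.
apply/matrixP => i j; rewrite !mxE; congr (nat_of_bool _)%:R.
have := ltn_ord i; have := ltn_ord j; rewrite !sE; do !case: ifP => ?; lia.
Qed.

Lemma unit_split_saturated (A : idomainType) (c : A) :
  split_saturated h (c%:M + matrix_unit A n n.-1 n).
Proof.
apply: (@split_saturated_conjugate _ _ _ (c%:M + standard n 0)).
  by rewrite /standard scale0r add0r; apply/conjugate_scalarD/matrix_unit_conjugate.
exact: standard_split_saturated.
Qed.

Lemma diag12_line (A : idomainType) (a c1 c2 : A) :
  a *: diag12 n c1 c2 + matrix_unit A n 1 n = (a * c2)%:M + standard n (a * (c1 - c2)).
Proof.
rewrite /standard addrA; congr (_ + _); apply/matrixP => i j; rewrite !mxE -[i == j]val_eqE /=.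
case: (eqVneq (i : nat) j) => [ij|nij]; rewrite ?mulr1n ?mulr0n.
  case: (eqVneq (i : nat) 0%N) => [i_0|i_0].
    have -> : (i.+1 == 1)%N && (j.+1 == 1)%N by lia.
    by rewrite mulr1; ring.
  have -> : (i.+1 == 1)%N && (j.+1 == 1)%N = false by lia.
  by rewrite mulr0n mulr0 addr0.
have -> : (i.+1 == 1)%N && (j.+1 == 1)%N = false by lia.
by rewrite mulr0n !mulr0 addr0.
Qed.

Lemma matrix_unit_delta (A : idomainType) : matrix_unit A n 1 n = delta_mx i0 ilast.
Proof.
by apply/matrixP => i j; rewrite !mxE -!val_eqE /=; congr (nat_of_bool _)%:R; lia.
Qed.

(** With D the diagonal matrix and E = E_(0,n-1), one has D E = c1 E, E D = c2 E
    and E E = 0. Hence 1 + s E conjugates a D to a D + E for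
    s = 1 / (a (c2 - c1)). *)
Lemma diag12_line_conjugate (k : fieldType) (a c1 c2 : k) : a != 0 -> c1 != c2 ->
  conjugate (a *: diag12 n c1 c2 + matrix_unit k n 1 n) (a *: diag12 n c1 c2).
Proof.
move=> a0 c12; rewrite matrix_unit_delta; set D := diag12 n c1 c2; set E := delta_mx _ _.
have EE : E *m E = 0.
  by rewrite mul_delta_mx_0 // -val_eqE /=; lia.
have DE : D *m E = c1 *: E.
  apply/matrixP => i j; rewrite mul_diag_mx !mxE /= -[i == i0]val_eqE /=.
  by case: eqP => //= _; rewrite !mulr0.
have ED : E *m D = c2 *: E.
  apply/matrixP => i j; rewrite mul_mx_diag !mxE /= -[j == ilast]val_eqE /=.
  have [jn|jn] := eqVneq (j : nat) n.-1; last by rewrite andbF mul0r mulr0.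
  have -> : (j == 0 :> nat) = false by lia.
  exact: mulrC.
pose s := (a * (c2 - c1))^-1.
apply: (@conjugate_intro _ _ _ _ (1%:M + s *: E)).
  suff : (1%:M + s *: E) *m (1%:M - s *: E) = 1%:M by move/mulmx1_unit => [].
  rewrite mulmxDl mul1mx mulmxBr mulmx1 -scalemxAl -scalemxAr EE !scaler0 subr0.
  by rewrite subrK.
rewrite mulmxDr mulmx1 !mulmxDl mul1mx -!scalemxAl -!scalemxAr DE ED EE !scaler0 addr0.
rewrite -!addrA; congr (_ + _); rewrite !scalerA -{1}[E]scale1r -scalerDl; congr (_ *: _).
have c21 : c2 - c1 != 0 by rewrite subr_eq0 eq_sym.
by rewrite /s; field; rewrite a0 c21.
Qed.

End MinimalSheet.

Section Degeneration.
Variables (k : fieldType) (n : nat) (h : 'I_n -> 'I_n).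
Hypotheses (n_gt1 : (1 < n)%N) (hh : hessenberg h).

Lemma sheet_line_split_saturated (x : 'M[k]_n) xt : sheet_line x xt -> split_saturated h xt.
Proof.
case=> [[c1 [c2 [_ _ ->]]]|[c [_ ->]]]; last exact: unit_split_saturated.
have -> : map_mx polyC (diag12 n c1 c2) = diag12 n c1%:P c2%:P.
  by apply/matrixP => i j; rewrite !mxE rmorphMn /=; case: (val i == 0)%N.
by rewrite diag12_line //; apply: standard_split_saturated.
Qed.

Lemma eval_matrix_unit (a : k) p q :
  map_mx (horner_eval a) (matrix_unit {poly k} n p q) = matrix_unit k n p q.
Proof. by apply/matrixP => i j; rewrite !mxE rmorph_nat. Qed.

Lemma sheet_line_degeneration (x nilp : 'M[k]_n) : minimal_sheet x -> minimal_nilpotent nilp ->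
  admits_flat_degeneration (hess_scheme x h) (hess_scheme nilp h).
Proof.
move=> [[c1 [c2 [c12 xD]]]|[c xc]] /conjugate_sym nilpE.
  pose xt : 'M[{poly k}]_n := 'X *: map_mx polyC (diag12 n c1 c2) + matrix_unit _ n 1 n.
  have wt : split_saturated h xt by apply: (@sheet_line_split_saturated x); left; exists c1, c2.
  have evE a : map_mx (horner_eval a) xt = a *: diag12 n c1 c2 + matrix_unit k n 1 n.
    rewrite /xt map_mxD map_mxZ eval_matrix_unit /= /horner_eval hornerX; congr (_ *: _ + _).
    by apply/matrixP => i j; rewrite !mxE /horner_eval hornerC.
  have wa a : split_saturated h (map_mx (horner_eval a) xt).
    by rewrite evE diag12_line //; apply: standard_split_saturated.
  have fib a := hess_scheme_fiber wt (wa a).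
  exists (hess_scheme xt h); split=> [|a a0|].
  - exact: split_saturated_flat.
  - apply: isomorphic_trans (fib a) _; rewrite evE.
    apply: isomorphic_trans (hess_scheme_conjugate h (diag12_line_conjugate n_gt1 a0 c12)) _.
    rewrite -[a *: _]addr0 -(raddf0 (@scalar_mx k n)).
    apply: isomorphic_trans (hess_scheme_affine _ _ hh _) _; first by rewrite unitfE.
    exact/hess_scheme_conjugate/conjugate_sym.
  - apply: isomorphic_trans (fib 0) _; rewrite evE scale0r add0r.
    exact: hess_scheme_conjugate.
pose xt : 'M[{poly k}]_n := ('X * c%:P)%:M + matrix_unit _ n n.-1 n.
have wt : split_saturated h xt by apply: unit_split_saturated.
have evE a : map_mx (horner_eval a) xt = (a * c)%:M + matrix_unit k n n.-1 n.
  by rewrite /xt map_mxD map_scalar_mx eval_matrix_unit /= /horner_eval hornerM hornerX hornerC.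
have wa a : split_saturated h (map_mx (horner_eval a) xt).
  by rewrite evE; apply: unit_split_saturated.
have fib a := hess_scheme_fiber wt (wa a).
exists (hess_scheme xt h); split=> [|a _|].
- exact: split_saturated_flat.
- apply: isomorphic_trans (fib a) _; rewrite evE.
  have -> : (a * c)%:M + matrix_unit k n n.-1 n =
      1 *: (c%:M + matrix_unit k n n.-1 n) + (a * c - c)%:M.
    by rewrite scale1r raddfB /= addrAC [X in _ = X + _]addrC subrK.
  apply: isomorphic_trans (hess_scheme_affine _ _ hh (unitr1 _)) _.
  exact/hess_scheme_conjugate/conjugate_sym.
- apply: isomorphic_trans (fib 0) _; rewrite evE mul0r raddf0 add0r.
  apply: isomorphic_trans (hess_scheme_conjugate h (matrix_unit_conjugate n_gt1 k)) _.
  exact: hess_scheme_conjugate.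
Qed.

End Degeneration.

Theorem theorem3p16 (R : realType) (n : nat) (hn : (2 <= n)%N)
    (h : 'I_n -> 'I_n) (hh : hessenberg h)
    (x : 'M[R[i]]_n) (hx : minimal_sheet x) :
  (forall xt : 'M[{poly R[i]}]_n, sheet_line x xt -> flat (hess_scheme xt h)) /\
  (forall nilp : 'M[R[i]]_n, minimal_nilpotent nilp ->
     admits_flat_degeneration (hess_scheme x h) (hess_scheme nilp h)).
Proof.
split=> [xt xxt|nilp nilpE].
  exact/split_saturated_flat/(sheet_line_split_saturated hn hh xxt).
exact: sheet_line_degeneration.
Qed.
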